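(* Fix $0<q<1$. Then $$\lim_{n\to\infty}\sup_{G\in\mathcal G}\big|\mathcal R_n(\hat T_{q,n},G)-\tilde{\mathcal R}(T_q,G)\big|=0,$$ and consequently, for every $0<p<2$ and $\eta>0$, $\lim_{n\to\infty}\sup_{G\in\mathcal G_p(\eta)}|\mathcal R_n(\hat T_{q,n},G)-\tilde{\mathcal R}(T_q,G)|=0$.
   Context: $E(t)=1-e^{-t}$, $\bar E=1-E$, $\bar G=1-G$ for a cdf $G$. $\mathcal F$: probability distributions on $[1,\infty)$; $\mathcal G=\{E\#F:F\in\mathcal F\}$ where $(E\#F)(t)=\int E(t/\mu)\,dF(\mu)$; $\mathcal G_p(\eta)=\{E\#F:\int\log^p\mu\,dF\le\eta^p\}$. FDR functional $T_q(G)=\inf\{t:\bar G(t)\ge\frac1q\bar E(t)\}$ ($\inf\emptyset=+\infty$), applied to any cdf. Bayesian model: $(\mu_i,X_i)$, $i=1,\dots,n$, i.i.d. with $\mu_i\sim F$ and $X_i\mid\mu_i\sim\mathrm{Exp}(\mu_i)$ (mean $\mu_i$), so $X_i\sim G=E\#F$. Empirical cdf $G_n(t)=\frac1n\sum_i\mathbb 1\{X_i<t\}$. Threshold $\hat T_{q,n}=T_q(G_n)$ if $T_q(G_n)<\infty$, and $\hat T_{q,n}=\log(n/q)$ otherwise. Estimator: $\hat\mu_i=X_i$ if $X_i\ge\hat T_{q,n}$, else $1$; risk $\mathcal R_n(\hat T_{q,n},G)=\mathbb{E}[\frac1n\sum_i(\log\hat\mu_i-\log\mu_i)^2]$. Ideal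 risk: $\tilde{\mathcal R}(T_q,G)=\mathbb{E}(\log\delta_{T_q(G)}(X_1)-\log\mu_1)^2$ with $\delta_t(x)=x$ if $x\ge t$ and $1$ otherwise ($\delta_{+\infty}\equiv1$). *)

(* Defs.v *)
From HB Require Import structures.
From mathcomp Require Import all_boot all_order all_algebra.
From mathcomp Require Import all_classical all_reals all_analysis.
Set Implicit Arguments. Unset Strict Implicit. Unset Printing Implicit Defensive.
Import Order.TTheory GRing.Theory Num.Theory.
Import numFieldNormedType.Exports.
Local Open Scope classical_set_scope.
Local Open Scope ring_scope.

Section Defs.
Variable R : realType.

Definition Ecdf (t : R) : R := if t < 0 then 0 else 1 - expR (- t).

Definition priors : set (probability R R) :=
  [set F | F `[1, +oo[%classic = 1%E].

Definition priors_p (p eta : R) : set (probability R R) :=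
  [set F | F \in priors /\
     (\int[F]_(mu in setT) ((ln mu) `^ p)%:E <= (eta `^ p)%:E)%E].

Definition mixcdf (F : probability R R) (t : R) : R :=
  fine (\int[F]_(mu in setT) (Ecdf (t / mu))%:E).

(* FDR functional T_q(G) = inf {t : 1 - G t >= (1/q)(1 - E t)}, inf set0 = +oo *)
Definition Tq (q : R) (G : R -> R) : \bar R :=
  ereal_inf [set t%:E | t in [set t | q^-1 * (1 - Ecdf t) <= 1 - G t]].

Definition delta (t : \bar R) (x : R) : R :=
  match t with
  | r%:E => if r <= x then x else 1
  | +oo%E => 1
  | -oo%E => x
  end.

(* Law of (mu, X): mu ~ F, X | mu ~ Exp with mean mu (density e^{-x/mu}/mu on (0,oo)).
   joint F g = E[g(mu, X)] for nonnegative g. *)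
Definition joint (F : probability R R) (g : R -> R -> \bar R) : \bar R :=
  (\int[F]_(mu in setT)
     \int[@lebesgue_measure R]_(x in `]0%R, +oo[%classic)
        (g mu x * (mu^-1 * expR (- (x / mu)))%:E))%E.

(* Expectation over n i.i.d. copies (mu_i, X_i) (iterated integral, nonneg. f);
   the sample is a sequence of pairs (mu_i, X_i). *)
Fixpoint iid (F : probability R R) (n : nat) (f : seq (R * R) -> \bar R) : \bar R :=
  match n with
  | 0%N => f [::]
  | n'.+1 => joint F (fun mu x => iid F n' (fun s => f ((mu, x) :: s)))
  end.

Definition Gn (s : seq (R * R)) (t : R) : R :=
  (size [seq p <- s | p.2 < t])%:R / (size s)%:R.

Definition That (q : R) (n : nat) (s : seq (R * R)) : \bar R :=
  match Tq q (Gn s) with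
  | r%:E => r%:E
  | _ => (ln (n%:R / q))%:E
  end.

Definition Rn (q : R) (n : nat) (F : probability R R) : \bar R :=
  iid F n (fun s => ((n%:R)^-1 *
     \sum_(p <- s) (ln (delta (That q n s) p.2) - ln p.1) ^+ 2)%:E).

Definition Rtilde (q : R) (F : probability R R) : \bar R :=
  joint F (fun mu x => ((ln (delta (Tq q (mixcdf F)) x) - ln mu) ^+ 2)%:E).

End Defs.

(* Main.v *)
(* Write g t for the upper tail of the mixture and H t = e^t g t, the integral of e^(t (1 - 1/mu)) dF.
   H is convex with H 0 = 1, and T_q is where it reaches 1/q; hence H ((1 -+ d) T_q) stays away from 1/q
   by a margin that depends only on d and q, and Chebyshev's inequality at finitely many points keeps the
   empirical threshold within a factor 1 -+ d of T_q as long as T_q is bounded by some A.  Since the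
   conditional risk is Lipschitz in the threshold, uniformly in mu, the two risks then agree up to O(d).
   If T_q > A, both risks are small: ln^2 mu <= 4 mu (1 - 1/mu)^2, and the integral of (1 - 1/mu)^2 dF is
   at most 4 / (q t^2) for every t < T_q, so missing the large means costs O(b / t^2) when the
   threshold is at most b = O(t).  The exceptional event is absorbed by fourth moments.

   The empirical threshold is never shown to be measurable: for a nonnegative function the integral is
   a lower integral, which is monotone, and subadditive as soon as one summand is measurable. *)
Require Import Defs.
From HB Require Import structures.
From mathcomp Require Import all_boot all_order all_algebra.
From mathcomp Require Import all_classical all_reals all_analysis.
From mathcomp Require Import measurable_realfun ring lra.
Import Order.TTheory GRing.Theory Num.Theory.
Import numFieldNormedType.Exports.
Local Open Scope classical_set_scope.
Local Open Scope ring_scope.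
Set Implicit Arguments. Unset Strict Implicit. Unset Printing Implicit Defensive.

(** The priors share no moment bound, so nothing uniform is known about [ln mu] itself. What is
    uniform is conditional: given [mu], the density of the observation is at most [1 / mu], so an
    observation below [b] has probability at most [b / mu], which beats the powers of [ln mu] that
    occur; and [ln x - ln mu] has moments bounded independently of [mu]. The fourth moment of the
    envelope of the losses is therefore of the order of the largest possible threshold, and the
    empirical threshold never exceeds [ln (n / q)], which is only logarithmic in [n]. Good and bad
    events are never measured as sets. Chebyshev's inequality enters as a pointwise bound of one
    sample loss by another, plus a sum of one-observation errors, plus a multiple of squared
    deviations of counts at deterministic points. Only these explicit errors are integrated
    separately, so the loss containing the empirical threshold may stand on either side, and both
    one-sided comparisons of the risks are instances of one lemma. *)

(** * Lower integrals of nonmeasurable functions *)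

Section lower_integral.
Context d (T : measurableType d) (R : realType).
Variable mu : {measure set T -> \bar R}.
Implicit Types f g : T -> \bar R.
Local Open Scope ereal_scope.
Import HBNNSimple.

Lemma le_lower_integral f M : (forall x, 0 <= f x) ->
  (forall h : T -> R, measurable_fun setT h -> (forall x, 0 <= h x)%R ->
     (forall x, (h x)%:E <= f x) -> \int[mu]_x (h x)%:E <= M) ->
  \int[mu]_x f x <= M.
Proof.
move=> f0 H; rewrite ge0_integralTE//; apply: ge_ereal_sup => _ [h hf <-].
by rewrite -integralT_nnsfun; apply: H.
Qed.

Lemma le_integral_lower f g : (forall x, 0 <= f x) -> (forall x, f x <= g x) ->
  \int[mu]_x f x <= \int[mu]_x g x.
Proof.
move=> f0 fg; have g0 x : 0 <= g x by exact: le_trans (fg x).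
rewrite !ge0_integralTE//; apply: ereal_sup_le => _ [h hf <-].
by exists h => // x; exact: le_trans (fg x).
Qed.

Lemma le_integral_lower_in (D : set T) f g :
  (forall x, D x -> 0 <= f x) -> (forall x, D x -> f x <= g x) ->
  \int[mu]_(x in D) f x <= \int[mu]_(x in D) g x.
Proof.
move=> f0 fg; rewrite (integral_mkcond D f) (integral_mkcond D g).
apply: le_integral_lower => x; rewrite !patchE; case: ifPn => // /set_mem Dx.
- exact: f0.
- exact: fg.
Qed.

(** If [h] is a measurable minorant of [f + g], the positive part of [h - g] is a measurable
    minorant of [f], and adding [g] to it dominates [h]. Measurability of [f] never enters. *)
Lemma integral_lowerD f g : (forall x, 0 <= f x) -> (forall x, 0 <= g x) ->
  measurable_fun setT g ->
  \int[mu]_x (f x + g x) <= \int[mu]_x f x + \int[mu]_x g x.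
Proof.
move=> f0 g0 mg; apply: le_lower_integral => [x|h mh h0 hfg].
  by rewrite adde_ge0.
pose k x := maxe ((h x)%:E - g x) 0.
have k0 x : 0 <= k x by rewrite /k le_max lexx orbT.
have mk : measurable_fun setT k.
  apply: measurable_maxe => //; apply: emeasurable_funB => //.
  exact/measurable_EFinP.
have kf x : k x <= f x.
  rewrite /k ge_max f0 andbT; have := hfg x; have := g0 x.
  by case: (g x) => [r| |] // _; [rewrite leeBlDr|rewrite addeNy leNye].
have hkg x : (h x)%:E <= k x + g x.
  have := k0 x; rewrite /k; have := g0 x; case: (g x) => [r| |] // _ k0x.
  - by rewrite -leeBlDr// le_max lexx.
  - by rewrite addey ?leey// gt_eqF// (lt_le_trans _ k0x).
apply: (@le_trans _ _ (\int[mu]_x (k x + g x))); last first.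
  by rewrite ge0_integralD//; apply: leeD => //; exact: le_integral_lower.
by apply: le_integral_lower => // x; rewrite lee_fin.
Qed.

Lemma integral_lowerD_in (D : set T) f g : measurable D ->
  (forall x, D x -> 0 <= f x) -> (forall x, D x -> 0 <= g x) ->
  measurable_fun D g ->
  \int[mu]_(x in D) (f x + g x) <= \int[mu]_(x in D) f x + \int[mu]_(x in D) g x.
Proof.
move=> mD f0 g0 mg; rewrite [leLHS]integral_mkcond (integral_mkcond D f).
rewrite (integral_mkcond D g).
apply: le_trans (integral_lowerD _ _ _); last 3 first.
- by move=> x; exact: erestrict_ge0.
- by move=> x; exact: erestrict_ge0.
- exact/(measurable_restrictT _ _).1.
rewrite le_eqVlt; apply/orP; left; apply/eqP; apply: eq_integral => x _.
by rewrite !patchE; case: ifPn => //; rewrite adde0.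
Qed.

(** A negligible set can be removed under each measurable minorant, hence under the supremum; a
    signed [f] is split into its positive and negative parts. *)
Lemma integral_lower_full (D : set T) f : measurable D -> mu (~` D) = 0 ->
  \int[mu]_x f x = \int[mu]_(x in D) f x.
Proof.
move=> mD D0.
have full g : (forall x, 0 <= g x) -> \int[mu]_x g x = \int[mu]_(x in D) g x.
  move=> g0; apply/eqP; rewrite eq_le; apply/andP; split; last first.
    rewrite integral_mkcond; apply: le_integral_lower => x; rewrite patchE.
      by case: ifP.
    by case: ifP.
  apply: le_lower_integral => // h mh h0 hg.
  rewrite (@ge0_negligible_integral _ _ _ mu setT (~` D))//=.
  - by rewrite setTD setCK; apply: le_integral_lower_in => x _ //; rewrite lee_fin.
  - exact: measurableC.
  - exact/measurable_EFinP.
  - by move=> x _; rewrite lee_fin.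
by rewrite integralE [RHS]integralE !full.
Qed.

End lower_integral.

Lemma measurable_invr (R : realType) : measurable_fun setT (@GRing.inv R).
Proof.
rewrite -(setUv [set (0 : R)]); apply/measurable_funU => //.
  exact: measurableC.
split; first exact: measurable_fun_set1.
apply: open_continuous_measurable_fun.
  by rewrite openC; exact: closed_eq.
by move=> x /set_mem /eqP x0; exact: inv_continuous.
Qed.

(** * The joint law of a mean and its observation *)

Section joint.
Context (R : realType) (F : probability R R).
Hypothesis hF : F \in @priors R.
Local Open Scope ereal_scope.
Local Notation lebesgue := (@lebesgue_measure R).
Local Notation itv1y := (`[1%R, +oo[%classic : set R).
Local Notation itv0y := (`]0%R, +oo[%classic : set R).

Definition dens (mu x : R) : R := (mu^-1 * expR (- (x / mu)))%R.

Lemma dens_ge0 (mu x : R) : (1 <= mu)%R -> (0 <= dens mu x)%R.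
Proof.
by move=> mu1; rewrite mulr_ge0 ?expR_ge0// invr_ge0 (le_trans _ mu1).
Qed.

Lemma measurable_dens : measurable_fun setT (fun z : R * R => dens z.1 z.2).
Proof.
apply: measurable_funM.
  by apply: measurableT_comp => //; exact: measurable_invr.
apply: measurableT_comp => //; apply: measurableT_comp => //.
apply: measurable_funM => //; apply: measurableT_comp => //.
exact: measurable_invr.
Qed.

Lemma prior_itv : F itv1y = 1.
Proof. by have := hF; rewrite inE. Qed.

Lemma prior_setC : F (~` itv1y) = 0.
Proof. by rewrite probability_setC// prior_itv subee. Qed.

Lemma jointE (g : R -> R -> \bar R) : joint F g =
  \int[F]_(mu in itv1y) \int[lebesgue]_(x in itv0y) (g mu x * (dens mu x)%:E).
Proof. exact: (integral_lower_full _ _ prior_setC). Qed.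

Lemma mem_itv1y (mu : R) : itv1y mu <-> (1 <= mu)%R.
Proof. by rewrite /= in_itv/= andbT. Qed.

Lemma mem_itv0y (x : R) : itv0y x <-> (0 < x)%R.
Proof. by rewrite /= in_itv/= andbT. Qed.

Lemma joint_ge0 (g : R -> R -> \bar R) :
  (forall mu x, (1 <= mu)%R -> (0 < x)%R -> 0 <= g mu x) -> 0 <= joint F g.
Proof.
move=> g0; rewrite jointE; apply: integral_ge0 => mu /mem_itv1y mu1.
apply: integral_ge0 => x /mem_itv0y x0.
by rewrite mule_ge0 ?g0// lee_fin dens_ge0.
Qed.

Lemma le_joint (f g : R -> R -> \bar R) :
  (forall mu x, (1 <= mu)%R -> (0 < x)%R -> 0 <= f mu x) ->
  (forall mu x, (1 <= mu)%R -> (0 < x)%R -> f mu x <= g mu x) ->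
  joint F f <= joint F g.
Proof.
move=> f0 fg; rewrite !jointE; apply: le_integral_lower_in => mu /mem_itv1y mu1.
  apply: integral_ge0 => x /mem_itv0y x0.
  by rewrite mule_ge0 ?f0// lee_fin dens_ge0.
apply: le_integral_lower_in => x /mem_itv0y x0.
  by rewrite mule_ge0 ?f0// lee_fin dens_ge0.
by rewrite lee_wpmul2r ?fg// lee_fin dens_ge0.
Qed.

Lemma measurable_slice (g : R -> R -> \bar R) (mu : R) :
  measurable_fun setT (fun z : R * R => g z.1 z.2) ->
  measurable_fun itv0y (fun x => g mu x * (dens mu x)%:E).
Proof.
move=> mg; apply: measurable_funTS; apply: emeasurable_funM.
  exact: (measurableT_comp mg (pair1_measurable mu)).
apply/measurable_EFinP.
exact: (measurableT_comp measurable_dens (pair1_measurable mu)).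
Qed.

(** Tonelli, applied to the integrand extended by zero outside the quadrant where it is
    nonnegative. *)
Lemma measurable_inner (g : R -> R -> \bar R) :
  measurable_fun setT (fun z : R * R => g z.1 z.2) ->
  (forall mu x, (1 <= mu)%R -> (0 < x)%R -> 0 <= g mu x) ->
  measurable_fun itv1y
    (fun mu => \int[lebesgue]_(x in itv0y) (g mu x * (dens mu x)%:E)).
Proof.
move=> mg g0.
pose h := (fun z : R * R => g z.1 z.2 * (dens z.1 z.2)%:E) \_ (itv1y `*` itv0y).
have mI : measurable (itv1y `*` itv0y) by exact: measurableX.
have mh : measurable_fun setT h.
  apply/(measurable_restrictT _ _).1 => //; apply: measurable_funTS.
  by apply: emeasurable_funM => //; apply/measurable_EFinP; exact: measurable_dens.
have h0 z : 0 <= h z.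
  apply: erestrict_ge0 => -[mu x] [/mem_itv1y mu1 /mem_itv0y x0] /=.
  by rewrite mule_ge0 ?g0// lee_fin dens_ge0.
have mF := @measurable_fun_fubini_tonelli_F _ _ _ _ R lebesgue h mh h0.
apply: (eq_measurable_fun (fubini_F lebesgue h)); last exact: measurable_funTS.
move=> mu /set_mem mu1; rewrite /fubini_F [RHS]integral_mkcond.
apply: eq_integral => x _; rewrite /h !patchE.
by rewrite in_setX /= (mem_set mu1).
Qed.

Lemma joint_lowerD (f g : R -> R -> \bar R) :
  (forall mu x, (1 <= mu)%R -> (0 < x)%R -> 0 <= f mu x) ->
  (forall mu x, (1 <= mu)%R -> (0 < x)%R -> 0 <= g mu x) ->
  measurable_fun setT (fun z : R * R => g z.1 z.2) ->
  joint F (fun mu x => f mu x + g mu x) <= joint F f + joint F g.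
Proof.
move=> f0 g0 mg; rewrite !jointE.
have K h mu : (forall x, (0 < x)%R -> 0 <= h x) -> (1 <= mu)%R ->
    0 <= \int[lebesgue]_(x in itv0y) (h x * (dens mu x)%:E).
  move=> h0 mu1; apply: integral_ge0 => x /mem_itv0y x0.
  by rewrite mule_ge0 ?h0// lee_fin dens_ge0.
apply: le_trans (integral_lowerD_in _ _ _ _ _); last 4 first.
- by [].
- by move=> mu /mem_itv1y mu1; apply: (K (f mu)) => // x x0; exact: f0.
- by move=> mu /mem_itv1y mu1; apply: (K (g mu)) => // x x0; exact: g0.
- exact: measurable_inner.
apply: le_integral_lower_in => mu /mem_itv1y mu1.
  by apply: (K (fun x => f mu x + g mu x)) => // x x0; rewrite adde_ge0 ?f0 ?g0.
apply: le_trans (integral_lowerD_in _ _ _ _ _); last 4 first.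
- by [].
- by move=> x /mem_itv0y x0; rewrite mule_ge0 ?f0// lee_fin dens_ge0.
- by move=> x /mem_itv0y x0; rewrite mule_ge0 ?g0// lee_fin dens_ge0.
- exact: measurable_slice.
apply: le_integral_lower_in => x /mem_itv0y x0.
  by rewrite mule_ge0 ?adde_ge0 ?f0 ?g0// lee_fin dens_ge0.
by rewrite ge0_muleDl ?f0 ?g0.
Qed.

Lemma jointD (f g : R -> R -> \bar R) :
  (forall mu x, (1 <= mu)%R -> (0 < x)%R -> 0 <= f mu x) ->
  (forall mu x, (1 <= mu)%R -> (0 < x)%R -> 0 <= g mu x) ->
  measurable_fun setT (fun z : R * R => f z.1 z.2) ->
  measurable_fun setT (fun z : R * R => g z.1 z.2) ->
  joint F (fun mu x => f mu x + g mu x) = joint F f + joint F g.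
Proof.
move=> f0 g0 mf mg; rewrite !jointE.
have K h mu : (forall x, (0 < x)%R -> 0 <= h x) -> (1 <= mu)%R ->
    0 <= \int[lebesgue]_(x in itv0y) (h x * (dens mu x)%:E).
  move=> h0 mu1; apply: integral_ge0 => x /mem_itv0y x0.
  by rewrite mule_ge0 ?h0// lee_fin dens_ge0.
rewrite -ge0_integralD//; last 4 first.
- by move=> mu /mem_itv1y mu1; apply: (K (f mu)) => // x x0; exact: f0.
- exact: measurable_inner.
- by move=> mu /mem_itv1y mu1; apply: (K (g mu)) => // x x0; exact: g0.
- exact: measurable_inner.
apply: eq_integral => mu /set_mem /mem_itv1y mu1.
rewrite -ge0_integralD//; last 4 first.
- by move=> x /mem_itv0y x0; rewrite mule_ge0 ?f0// lee_fin dens_ge0.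
- exact: measurable_slice.
- by move=> x /mem_itv0y x0; rewrite mule_ge0 ?g0// lee_fin dens_ge0.
- exact: measurable_slice.
apply: eq_integral => x /set_mem /mem_itv0y x0.
by rewrite ge0_muleDl ?f0 ?g0.
Qed.

Lemma jointZ (k : R) (f : R -> R -> \bar R) : (0 <= k)%R ->
  (forall mu x, (1 <= mu)%R -> (0 < x)%R -> 0 <= f mu x) ->
  measurable_fun setT (fun z : R * R => f z.1 z.2) ->
  joint F (fun mu x => k%:E * f mu x) = k%:E * joint F f.
Proof.
move=> k0 f0 mf; rewrite !jointE -ge0_integralZl_EFin//; last 2 first.
- move=> mu /mem_itv1y mu1; apply: integral_ge0 => x /mem_itv0y x0.
  by rewrite mule_ge0 ?f0// lee_fin dens_ge0.
- exact: measurable_inner.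
apply: eq_integral => mu /set_mem /mem_itv1y mu1.
rewrite -ge0_integralZl_EFin//; last 2 first.
- by move=> x /mem_itv0y x0; rewrite mule_ge0 ?f0// lee_fin dens_ge0.
- exact: measurable_slice.
by apply: eq_integral => x _; rewrite muleA.
Qed.

Lemma joint_le_inner (f : R -> R -> \bar R) (h : R -> \bar R) :
  (forall mu x, (1 <= mu)%R -> (0 < x)%R -> 0 <= f mu x) ->
  (forall mu, (1 <= mu)%R ->
    \int[lebesgue]_(x in itv0y) (f mu x * (dens mu x)%:E) <= h mu) ->
  joint F f <= \int[F]_(mu in itv1y) h mu.
Proof.
move=> f0 fh; rewrite jointE; apply: le_integral_lower_in => mu /mem_itv1y mu1.
  apply: integral_ge0 => x /mem_itv0y x0.
  by rewrite mule_ge0 ?f0// lee_fin dens_ge0.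
exact: fh.
Qed.

End joint.

(** * Exponential tails and an integrable majorant uniform in the mean *)

Section exponential_integrals.
Context (R : realType).
Local Notation lebesgue := (@lebesgue_measure R).
Local Notation itv0y := (`]0, +oo[%classic : set R).

Lemma continuous_dens (mu : R) : continuous (dens mu).
Proof.
move=> x; apply: cvgM; first exact: cvg_cst.
apply: continuous_comp; last exact: continuous_expR.
by apply: cvgN; apply: cvgM; [exact: cvg_id|exact: cvg_cst].
Qed.

Lemma measurable_dens1 (mu : R) (D : set R) :
  measurable_fun D (fun x => (dens mu x)%:E).
Proof.
apply/measurable_EFinP; apply: measurable_funTS.
by apply: continuous_measurable_fun; exact: continuous_dens.
Qed.

Lemma integral_dens_tail (mu t : R) : 0 < mu ->
  (\int[lebesgue]_(x in `[t, +oo[) (dens mu x)%:E = (expR (- (t / mu)))%:E)%E.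
Proof.
move=> mu0.
have dF (x : R) : is_derive x (1 : R) (fun x : R => - expR (- (x / mu))) (dens mu x).
  have -> : (fun x : R => - expR (- (x / mu))) =
            (fun x : R => - expR ((- mu^-1) *: x)).
    by apply/funext => y; rewrite /GRing.scale /= mulNr (mulrC y).
  apply: is_derive_eq; rewrite /dens /GRing.scale /=.
  by rewrite mulr1 mulrN opprK [X in expR X]mulNr (mulrC x) [LHS]mulrC.
rewrite (@ge0_continuous_FTC2y _ _ (fun x => - expR (- (x / mu))) _ 0).
- by rewrite EFinN oppeK add0e.
- by move=> x _; rewrite mulr_ge0 ?expR_ge0// invr_ge0 ltW.
- by apply: continuous_subspaceT; exact: continuous_dens.
- rewrite -oppr0; apply: cvgN.
  apply: (@cvg_comp _ _ _ (fun x => x / mu) (fun y => expR (- y)) _ (pinfty_nbhs R)).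
    by apply: gt0_cvgMly; rewrite ?invr_gt0//; exact: cvg_id.
  exact: cvgr_expR.
- by move=> x _; have [] := dF x.
- apply/cvg_at_right_filter; have [/derivable1_diffP] := dF t.
  by move=> /differentiable_continuous.
- by move=> x _; rewrite derive1E; have [_ ->] := dF x.
Qed.

(* [wgt mu x] is the square root of [x / mu], and [psi mu] is the derivative of [- (1 + wgt mu x)^-1]. *)
Definition wgt (mu x : R) : R := expR ((ln x - ln mu) / 2).

Definition psi (mu x : R) : R := wgt mu x / (2 * x * (1 + wgt mu x) ^+ 2).

Lemma continuous_wgt (mu x : R) : 0 < x -> {for x, continuous (wgt mu)}.
Proof.
move=> x0; apply: continuous_comp; last exact: continuous_expR.
apply: cvgM; last exact: cvg_cst.
by apply: cvgB; [exact: continuous_ln|exact: cvg_cst].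
Qed.

Lemma wgt_gt0 (mu x : R) : 0 < wgt mu x.
Proof. exact: expR_gt0. Qed.

Lemma psi_ge0 (mu x : R) : 0 < x -> 0 <= psi mu x.
Proof.
move=> x0; rewrite /psi mulr_ge0 ?expR_ge0// invr_ge0.
by rewrite !mulr_ge0 ?exprn_ge0 ?addr_ge0 ?expR_ge0// ltW.
Qed.

Lemma continuous_psi (mu x : R) : 0 < x -> {for x, continuous (psi mu)}.
Proof.
move=> x0; have cw := @continuous_wgt mu x x0.
have -> : psi mu = fun x => wgt mu x / (2 * x * ((1 + wgt mu x) * (1 + wgt mu x))).
  by apply/funext => y; rewrite /psi expr2.
have w0 := wgt_gt0 mu x.
have w1 : 1 + wgt mu y @[y --> x] --> 1 + wgt mu x.
  by apply: cvgD => //; exact: cvg_cst.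
apply: cvgM => //; apply: cvgV.
  by rewrite !mulf_neq0 ?gt_eqF// addr_gt0.
apply: cvgM; last exact: cvgM.
by apply: cvgM; [exact: cvg_cst|exact: cvg_id].
Qed.

(** The antiderivative takes its values between -1 and 0, whence a bound that depends neither on
    [mu] nor on [a]. *)
Lemma integral_psi_le1 (mu a : R) : 0 < a ->
  (\int[lebesgue]_(x in `[a, +oo[) (psi mu x)%:E <= 1)%E.
Proof.
move=> a0; pose G x := - (1 + wgt mu x)^-1.
have w1 x : 0 < 1 + wgt mu x by rewrite addr_gt0 ?wgt_gt0.
have dG (x : R) : 0 < x -> is_derive x (1 : R) G (psi mu x).
  move=> x0; have dl := is_derive1_ln x0.
  have dw : is_derive x (1 : R) (wgt mu) (wgt mu x * (x^-1 / 2)).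
    have -> : wgt mu = expR \o (fun x => 2^-1 *: (ln x - ln mu)).
      by apply/funext => y; rewrite /wgt /= mulrC.
    apply: is_derive_eq; rewrite /wgt /GRing.scale /= subr0.
    by rewrite (mulrC x^-1).
  have dw1 : is_derive x (1 : R) (fun x => 1 + wgt mu x) (wgt mu x * (x^-1 / 2)).
    have := is_deriveD (is_derive_cst (1 : R) x (1 : R)) dw; by rewrite add0r.
  have dv := @is_deriveV R (fun x => 1 + wgt mu x) x _ 1 (lt0r_neq0 (w1 x)) dw1.
  apply: is_derive_eq; rewrite /GRing.scale /= /psi.
  have := lt0r_neq0 (w1 x); have := lt0r_neq0 x0 => xn wn.
  by field; rewrite xn wn.
rewrite (@ge0_continuous_FTC2y _ _ G _ 0).
- rewrite -EFinB lee_fin sub0r opprK invf_le1//.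
  by rewrite lerDl ltW ?wgt_gt0.
- by move=> x ax; rewrite psi_ge0// (lt_le_trans a0).
- apply: continuous_in_subspaceT => x /set_mem; rewrite /= in_itv/= andbT => ax.
  by apply: continuous_psi; exact: lt_le_trans ax.
- rewrite -oppr0; apply: cvgN; apply/gtr0_cvgV0; first exact: nearW.
  apply/cvgryPge => A.
  near=> x.
  have x0 : 0 < x by near: x; exact: nbhs_pinfty_gt.
  have xA : expR (2 * A + ln mu) <= x by near: x; exact: nbhs_pinfty_ge.
  have lA : 2 * A + ln mu <= ln x.
    by rewrite -[leLHS]expRK ler_ln ?posrE ?expR_gt0.
  have := expR_ge1Dx ((ln x - ln mu) / 2); rewrite -/(wgt mu x); lra.
- by move=> x ax; have [] := dG x (lt_trans a0 ax).
- apply/cvg_at_right_filter; have [/derivable1_diffP] := dG a a0.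
  by move=> /differentiable_continuous.
- move=> x; rewrite in_itv/= andbT => ax.
  by rewrite derive1E; have [_ ->] := dG x (lt_trans a0 ax).
Unshelve. all: by end_near. Qed.

End exponential_integrals.

(** * Conditional integrals for a fixed mean *)

Section conditional_bounds.
Context (R : realType).
Local Notation lebesgue := (@lebesgue_measure R).
Local Notation itv0y := (`]0, +oo[%classic : set R).
Implicit Types (mu a b t x M : R) (g : R -> R).

Lemma in_oy a x : (x \in (`]a, +oo[%classic : set R)) = (a < x).
Proof. by apply/idP/idP => [/set_mem|h]; [|apply/mem_set]; rewrite /= in_itv/= andbT. Qed.

Lemma in_cy a x : (x \in (`[a, +oo[%classic : set R)) = (a <= x).
Proof. by apply/idP/idP => [/set_mem|h]; [|apply/mem_set]; rewrite /= in_itv/= andbT. Qed.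

Lemma in_co a b x : (x \in (`[a, b[%classic : set R)) = (a <= x < b).
Proof. by apply/idP/idP => [/set_mem|h]; [|apply/mem_set]; rewrite /= in_itv. Qed.

(** Fourth power of [|z| <= 8 * expR (|z| / 8)]. The exponent 1/2 is the one that [wgt], a square
    root, can absorb. *)
Lemma expR_ge_pow4 (z : R) : z ^+ 4 <= 8 ^+ 4 * expR (`|z| / 2).
Proof.
have h : `|z| <= 8 * expR (`|z| / 8) by have := expR_ge1Dx (`|z| / 8); lra.
have -> : z ^+ 4 = `|z| ^+ 4 by rewrite -normrX ger0_norm// exprn_even_ge0.
apply: le_trans (lerXn2r 4 _ _ h) _; rewrite ?nnegrE ?mulr_ge0 ?expR_ge0//.
rewrite exprMn -expRM_natl ler_pM2l ?exprn_gt0// ler_expR; lra.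
Qed.

Lemma expR_ge_pow2 (z : R) : z ^+ 2 <= 8 ^+ 2 * expR (`|z| / 2).
Proof.
have h : `|z| <= 8 * expR (`|z| / 8) by have := expR_ge1Dx (`|z| / 8); lra.
have -> : z ^+ 2 = `|z| ^+ 2 by rewrite -normrX ger0_norm// exprn_even_ge0.
apply: le_trans (lerXn2r 2 _ _ h) _; rewrite ?nnegrE ?mulr_ge0 ?expR_ge0//.
rewrite exprMn -expRM_natl ler_pM2l ?exprn_gt0// ler_expR.
have := normr_ge0 z; lra.
Qed.

(* Near [0] the factor [wgt] absorbs the logarithmic singularity, at infinity the exponential absorbs everything. *)
Lemma log_dens_le_psi mu x (s c : R) : 1 <= mu -> 0 < x -> 0 <= c ->
  s <= c * expR (`|ln x - ln mu| / 2) ->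
  s * dens mu x <= 64 * c * expR (- (x / mu / 2)) * psi mu x.
Proof.
move=> mu1 x0 c0 hs.
have mu0 : 0 < mu by lra.
pose w := wgt mu x; have w0 : 0 < w by exact: wgt_gt0.
have wE : w ^+ 2 = x / mu.
  rewrite /w /wgt -expRM_natl mulrCA divff// mulr1 -ln_div ?posrE//.
  by rewrite lnK// posrE divr_gt0.
(* The exponential of half the absolute logarithm is the larger of [w] and its inverse, so its
   product with [w] is the larger of [w ^+ 2] and 1. *)
have hs2 : s * w <= c * (1 + w ^+ 2).
  have e1 : expR (`|ln x - ln mu| / 2) * w <= 1 + w ^+ 2.
    case: (ger0P (ln x - ln mu)) => h.
      by rewrite -/(wgt mu x) -/w -expr2; lra.
    by rewrite mulNr expRN -/(wgt mu x) -/w mulVf ?gt_eqF//; have := sqr_ge0 w; lra.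
  apply: (@le_trans _ _ (c * expR (`|ln x - ln mu| / 2) * w)).
    by rewrite ler_pM2r.
  by rewrite -mulrA ler_wpM2l.
(* One half of the exponential absorbs the polynomial in [w]; the other half survives as the decay
   factor of the conclusion. The constant 64 is 16 from [EE], times 2 from the denominator of [psi],
   times 2 from [k2]. *)
set E := expR (- (x / mu / 2)).
have E0 : 0 < E by exact: expR_gt0.
have eE : expR (- (x / mu)) = E * E by rewrite -expRD; congr expR; lra.
have EE : E * (1 + w ^+ 2) ^+ 2 <= 16.
  have := expR_ge1Dx (w ^+ 2 / 4) => h.
  have e4 : expR (w ^+ 2 / 4) ^+ 2 * E = 1.
    by rewrite -expRM_natl /E -expRD -wE -[RHS]expR0; congr expR; lra.
  have h2 : (1 + w ^+ 2) ^+ 2 <= 16 * expR (w ^+ 2 / 4) ^+ 2.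
    have -> : 16 * expR (w ^+ 2 / 4) ^+ 2 = (4 * expR (w ^+ 2 / 4)) ^+ 2 by ring.
    rewrite lerXn2r ?nnegrE ?mulr_ge0 ?expR_ge0 ?addr_ge0 ?sqr_ge0//.
    have := sqr_ge0 w; lra.
  have := ler_wpM2l (ltW E0) h2; have : E * (16 * expR (w ^+ 2 / 4) ^+ 2) = 16 by nra.
  lra.
have xE : x = mu * w ^+ 2 by rewrite wE mulrCA divff ?mulr1// gt_eqF.
have -> : psi mu x = mu^-1 / (2 * w * (1 + w) ^+ 2).
  rewrite /psi -/w xE; have := lt0r_neq0 mu0; have := lt0r_neq0 w0 => wn mn.
  have : 1 + w != 0 by rewrite gt_eqF//; lra.
  by move=> w1n; field; rewrite wn mn w1n.
rewrite /dens eE.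
rewrite [leLHS](_ : _ = mu^-1 * E * (s * E)); last by ring.
rewrite [leRHS](_ : _ = mu^-1 * E * (64 * c / (2 * w * (1 + w) ^+ 2))); last by ring.
rewrite ler_pM2l ?mulr_gt0 ?invr_gt0//.
have d0 : 0 < 2 * w * (1 + w) ^+ 2 by rewrite !mulr_gt0 ?exprn_gt0//; lra.
rewrite ler_pdivlMr//.
rewrite [leLHS](_ : _ = 2 * (E * (s * w) * (1 + w) ^+ 2)); last by ring.
have k1 : E * (s * w) <= E * (c * (1 + w ^+ 2)) by rewrite ler_pM2l.
have k2 : (1 + w) ^+ 2 <= 2 * (1 + w ^+ 2) by have := sqr_ge0 (1 - w); nra.
have k3 : E * (s * w) * (1 + w) ^+ 2 <= E * (c * (1 + w ^+ 2)) * (2 * (1 + w ^+ 2)).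
  apply: (@le_trans _ _ (E * (c * (1 + w ^+ 2)) * (1 + w) ^+ 2)).
    by rewrite ler_wpM2r// sqr_ge0.
  by rewrite ler_wpM2l// !mulr_ge0 ?addr_ge0 ?sqr_ge0 ?(ltW E0).
apply: (@le_trans _ _ (4 * c * (E * (1 + w ^+ 2) ^+ 2))).
  by rewrite [leRHS](_ : _ = 2 * (E * (c * (1 + w ^+ 2)) * (2 * (1 + w ^+ 2)))) ?ler_pM2l//; ring.
have := ler_wpM2l c0 EE; lra.
Qed.

Lemma inner_tail_le mu a M g : 0 < a -> 0 <= M -> 1 <= mu ->
  (forall x, 0 <= g x) -> (forall x, x < a -> g x = 0) ->
  (forall x, a <= x -> g x * dens mu x <= M * psi mu x) ->
  (\int[lebesgue]_(x in itv0y) ((g x)%:E * (dens mu x)%:E) <= M%:E)%E.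
Proof.
move=> a0 M0 mu1 g0 ga gM.
have mpsi : measurable_fun `[a, +oo[ (fun x => (psi mu x)%:E).
  apply/measurable_EFinP; apply: subspace_continuous_measurable_fun => //.
  apply: continuous_in_subspaceT => x /set_mem; rewrite /= in_itv/= andbT => ax.
  by apply: continuous_psi; exact: lt_le_trans ax.
apply: (@le_trans _ _ (M%:E * \int[lebesgue]_(x in `[a, +oo[) (psi mu x)%:E)%E); last first.
  by rewrite -[leRHS]mule1 lee_wpmul2l ?lee_fin ?integral_psi_le1.
rewrite -ge0_integralZl_EFin//; last first.
  move=> x /=; rewrite in_itv/= andbT => ax.
  by rewrite lee_fin psi_ge0// (lt_le_trans a0).
rewrite [leLHS]integral_mkcond [leRHS]integral_mkcond; apply: le_integral_lower => x.
  apply: erestrict_ge0 => y _.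
  by rewrite mule_ge0// lee_fin ?g0// dens_ge0.
rewrite !patchE in_oy in_cy /=; case: (ltP 0 x) => x0; last first.
  case: (leP a x) => // ax; rewrite mule_ge0 ?lee_fin ?psi_ge0//.
  exact: lt_le_trans ax.
by case: (leP a x) => ax; [have := gM x ax; rewrite -lee_fin !EFinM|rewrite ga// mul0e].
Qed.

Lemma inner_itv_le mu a b M g : 0 <= a -> a <= b -> 0 <= M -> 1 <= mu ->
  (forall x, 0 <= g x) -> (forall x, ~~ (a <= x < b) -> g x = 0) ->
  (forall x, 0 < x -> a <= x -> x < b -> g x * dens mu x <= M) ->
  (\int[lebesgue]_(x in itv0y) ((g x)%:E * (dens mu x)%:E) <= (M * (b - a))%:E)%E.
Proof.
move=> a0 ab M0 mu1 g0 gab gM.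
apply: (@le_trans _ _ (\int[lebesgue]_(x in `[a, b[) (cst M%:E x))%E); last first.
  rewrite integral_cst//= lebesgue_measure_itv/= lte_fin.
  by case: ltP => h; rewrite ?mule0 -?EFinD -?EFinM lee_fin// mulr_ge0// subr_ge0.
rewrite [leLHS]integral_mkcond [leRHS]integral_mkcond; apply: le_integral_lower => x.
  apply: erestrict_ge0 => y _.
  by rewrite mule_ge0// lee_fin ?g0// dens_ge0.
rewrite !patchE in_oy in_co /=; case: (ltP 0 x) => x0; last first.
  by case: ifP => // _; rewrite lee_fin.
case: ifPn => [/andP[ax xb]|abx]; first by have := gM x x0 ax xb; rewrite -lee_fin EFinM.
by rewrite gab// mul0e.
Qed.

Lemma inner_tail mu t : 0 <= t -> 1 <= mu ->
  (\int[lebesgue]_(x in itv0y) ((t <= x)%R%:R%:E * (dens mu x)%:E) =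
   (expR (- (t / mu)))%:E)%E.
Proof.
move=> t0 mu1; rewrite -(@integral_dens_tail _ mu t); last by lra.
rewrite integral_itv_obnd_cbnd; last first.
  apply: emeasurable_funM; last exact: measurable_dens1.
  apply/measurable_EFinP; apply: measurable_funTS.
  by apply: measurableT_comp => //; exact: measurable_fun_ler.
rewrite [LHS]integral_mkcond [RHS]integral_mkcond; apply: eq_integral => x _.
rewrite !patchE !in_cy; case: (leP t x) => tx; last by rewrite mul0e; case: ifP.
by rewrite (le_trans t0 tx) mul1e.
Qed.

End conditional_bounds.

(** * The upper tail of the mixture *)

Section joint_tail.
Context (R : realType) (F : probability R R).
Hypothesis hF : F \in @priors R.
Local Open Scope ereal_scope.
Local Notation itv1y := (`[1%R, +oo[%classic : set R).

Lemma eq_joint (f g : R -> R -> \bar R) :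
  (forall mu x, (1 <= mu)%R -> (0 < x)%R -> 0 <= f mu x) ->
  (forall mu x, (1 <= mu)%R -> (0 < x)%R -> f mu x = g mu x) ->
  joint F f = joint F g.
Proof.
move=> f0 fg; apply/eqP; rewrite eq_le !le_joint// => mu x mu1 x0.
- by rewrite -fg// f0.
- by rewrite fg.
- by rewrite fg.
Qed.

Definition tail (t : R) : R := (1 - mixcdf F t)%R.

Lemma measurable_expdiv (t : R) (D : set R) :
  measurable_fun D (fun mu => (expR (- (t / mu)))%:E).
Proof.
apply/measurable_EFinP; apply: measurable_funTS.
apply: measurableT_comp => //; apply: measurableT_comp => //.
by apply: measurable_funM => //; exact: measurable_invr.
Qed.

Lemma integral_tail (t : R) : (0 <= t)%R ->
  \int[F]_(mu in itv1y) (expR (- (t / mu)))%:E = (tail t)%:E.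
Proof.
move=> t0; rewrite /tail /mixcdf (integral_lower_full _ _ (prior_setC hF))//.
set a := (LHS).
have le1 (mu : R) : itv1y mu -> (expR (- (t / mu)) <= 1)%R.
  move=> /mem_itv1y mu1; rewrite -expR0 ler_expR oppr_le0 divr_ge0//; lra.
have mE : measurable_fun itv1y (fun mu => (Ecdf (t / mu))%:E).
  apply: (eq_measurable_fun (fun mu : R => (1 - (expR (- (t / mu)))%:E : \bar R)%E)).
    move=> mu /set_mem /mem_itv1y mu1; rewrite /Ecdf ltNge divr_ge0//; lra.
  by apply: emeasurable_funB => //; exact: measurable_expdiv.
have EE (mu : R) : itv1y mu -> Ecdf (t / mu) = (1 - expR (- (t / mu)))%R.
  move=> /mem_itv1y mu1; rewrite /Ecdf ltNge divr_ge0//; lra.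
set b := integral _ _ _.
(* The two nonnegative integrals add up to the mass of the prior, so both are finite and [fine] in
   [mixcdf] loses nothing. *)
have ab : a + b = 1.
  rewrite /a /b -ge0_integralD//.
  - rewrite (eq_integral (cst 1)) ?integral_cst ?mul1e//; first exact: prior_itv.
    by move=> mu /set_mem /EE ->; rewrite -EFinD addrC subrK.
  - exact: measurable_expdiv.
  - by move=> mu h; rewrite lee_fin EE// subr_ge0 le1.
have a0 : 0 <= a by apply: integral_ge0 => mu _; rewrite lee_fin expR_ge0.
have b0 : 0 <= b.
  by apply: integral_ge0 => mu h; rewrite lee_fin EE// subr_ge0 le1.
move: ab a0 b0; case: a => [a| |]; case: b => [b| |] //= [] <- _ _.
by rewrite addrK.
Qed.

Lemma measurable_ge_indicator (t : R) :
  measurable_fun setT (fun z : R * R => ((t <= z.2)%R%:R)%:E : \bar R).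
Proof.
apply/measurable_EFinP; apply: measurableT_comp => //.
exact: measurable_fun_ler.
Qed.

Lemma joint_tail (t : R) : (0 <= t)%R ->
  joint F (fun _ x => ((t <= x)%R%:R)%:E) = (tail t)%:E.
Proof.
move=> t0; rewrite jointE// -integral_tail//.
by apply: eq_integral => mu /set_mem /mem_itv1y mu1; exact: inner_tail.
Qed.

Lemma tail_ge0 (t : R) : (0 <= t)%R -> (0 <= tail t)%R.
Proof.
by move=> t0; rewrite -lee_fin -joint_tail// joint_ge0// => *; rewrite lee_fin.
Qed.

Lemma tail0 : tail 0 = 1%R.
Proof.
apply: EFin_inj; rewrite -integral_tail// (eq_integral (cst 1)).
  by rewrite integral_cst// mul1e; exact: prior_itv.
by move=> mu _; rewrite mul0r oppr0 expR0.
Qed.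

Lemma tail_nincr (s t : R) : (0 <= s)%R -> (s <= t)%R -> (tail t <= tail s)%R.
Proof.
move=> s0 st.
have : (joint F (fun _ x => ((t <= x)%R%:R)%:E) <= joint F (fun _ x => ((s <= x)%R%:R)%:E))%E.
  apply: le_joint => // mu x _ _; rewrite lee_fin// ler_nat.
  by case: (leP t x) => // /(le_trans st) ->.
by rewrite (joint_tail (le_trans s0 st)) (joint_tail s0) lee_fin.
Qed.

Lemma tail_le1 (t : R) : (0 <= t)%R -> (tail t <= 1)%R.
Proof. by move=> t0; rewrite -tail0 tail_nincr. Qed.

Lemma joint_cst (c : R) : (0 <= c)%R -> joint F (fun _ _ => c%:E) = c%:E.
Proof.
move=> c0; rewrite (eq_joint (g := fun _ x => c%:E * ((0 <= x)%R%:R)%:E)).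
- rewrite jointZ//; last exact: measurable_ge_indicator.
  by rewrite joint_tail// tail0 mule1.
- by move=> *; rewrite lee_fin.
- by move=> mu x _ x0; rewrite (ltW x0) mule1.
Qed.

End joint_tail.

(** * Expectations over samples and variances of counts *)

Section iid.
Context (R : realType) (F : probability R R).
Hypothesis hF : F \in @priors R.
Local Open Scope ereal_scope.
Implicit Types (f g : seq (R * R) -> \bar R) (s : seq (R * R)).

(** The samples that the iterated integral sees: inequalities between integrands are only required
    on them. *)
Definition sample (n : nat) (s : seq (R * R)) : bool :=
  (size s == n) && all (fun p : R * R => (1 <= p.1)%R && (0 < p.2)%R) s.

Lemma sample_cons n mu x s : (1 <= mu)%R -> (0 < x)%R -> sample n s ->
  sample n.+1 ((mu, x) :: s).
Proof. by move=> mu1 x0 /andP[/eqP sn hs]; rewrite /sample /= sn eqxx mu1 x0. Qed.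

Lemma iid_ge0 n f : (forall s, sample n s -> 0 <= f s) -> 0 <= iid F n f.
Proof.
elim: n f => [|n IH] f f0 /=; first exact: f0.
apply: joint_ge0 => // mu x mu1 x0; apply: IH => s hs.
by apply: f0; exact: sample_cons.
Qed.

Lemma le_iid n f g : (forall s, sample n s -> 0 <= f s) ->
  (forall s, sample n s -> f s <= g s) -> iid F n f <= iid F n g.
Proof.
elim: n f g => [|n IH] f g f0 fg /=; first exact: fg.
apply: le_joint => // mu x mu1 x0.
  by apply: iid_ge0 => s hs; apply: f0; exact: sample_cons.
by apply: IH => s hs; [apply: f0|apply: fg]; exact: sample_cons.
Qed.

(* Every partial expectation of [g] is a measurable function of the first coordinate left. *)
Fixpoint iid_measurable (n : nat) (g : seq (R * R) -> \bar R) : Prop :=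
  if n is n'.+1 then
    (forall p, iid_measurable n' (fun s => g (p :: s))) /\
    measurable_fun setT (fun z : R * R => iid F n' (fun s => g ((z.1, z.2) :: s)))
  else True.

Lemma iid_lowerD n f g : iid_measurable n g ->
  (forall s, sample n s -> 0 <= f s) -> (forall s, sample n s -> 0 <= g s) ->
  iid F n (fun s => f s + g s) <= iid F n f + iid F n g.
Proof.
elim: n f g => [|n IH] f g //= [mg1 mg] f0 g0.
have f0' mu x : (1 <= mu)%R -> (0 < x)%R -> forall s, sample n s -> 0 <= f ((mu, x) :: s).
  by move=> mu1 x0 s hs; apply: f0; exact: sample_cons.
have g0' mu x : (1 <= mu)%R -> (0 < x)%R -> forall s, sample n s -> 0 <= g ((mu, x) :: s).
  by move=> mu1 x0 s hs; apply: g0; exact: sample_cons.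
apply: le_trans (joint_lowerD hF _ _ _); last 3 first.
- by move=> mu x mu1 x0; apply: iid_ge0; exact: f0'.
- by move=> mu x mu1 x0; apply: iid_ge0; exact: g0'.
- exact: mg.
apply: le_joint => // mu x mu1 x0.
  by apply: iid_ge0 => s hs; rewrite adde_ge0 ?f0' ?g0'.
by apply: (IH (fun s => f ((mu, x) :: s)) (fun s => g ((mu, x) :: s))) => //;
  [exact: f0'|exact: g0'].
Qed.

(** The constant [c] is an accumulator: once the first pair is fixed, its term joins [c] and the
    induction hypothesis applies to the remaining pairs. *)
Lemma iid_sum n (c J : R) (phi : R * R -> R) : (0 <= c)%R ->
  (forall z, 0 <= phi z)%R -> measurable_fun setT phi ->
  joint F (fun mu x => (phi (mu, x))%:E) = J%:E ->
  iid F n (fun s => (c + \sum_(p <- s) phi p)%:E) = (c + n%:R * J)%:E.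
Proof.
move=> c0 phi0 mphi jphi.
have J0 : (0 <= J)%R by rewrite -lee_fin -jphi joint_ge0// => *; rewrite lee_fin.
elim: n c c0 => [|n IH] c c0 /=; first by rewrite big_nil mul0r !addr0.
have -> : (fun mu x => iid F n (fun s => (c + \sum_(p <- (mu, x) :: s) phi p)%:E)) =
    (fun mu x => (phi (mu, x))%:E + (c + n%:R * J)%:E).
  apply/funext => mu; apply/funext => x.
  rewrite -EFinD addrCA addrA -IH ?addr_ge0//.
  by congr iid; apply/funext => s; rewrite big_cons addrA.
rewrite jointD//.
- rewrite jphi joint_cst ?addr_ge0 ?mulr_ge0//.
  by rewrite -EFinD -natr1 mulrDl mul1r addrA addrC addrA (addrC c).
- by move=> *; rewrite lee_fin.
- by move=> *; rewrite lee_fin addr_ge0 ?mulr_ge0.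
- apply/measurable_EFinP; apply: eq_measurable_fun mphi.
  by move=> [a b] _.
Qed.

Lemma iid_measurable_sum n (c J : R) (phi : R * R -> R) : (0 <= c)%R ->
  (forall z, 0 <= phi z)%R -> measurable_fun setT phi ->
  joint F (fun mu x => (phi (mu, x))%:E) = J%:E ->
  iid_measurable n (fun s => (c + \sum_(p <- s) phi p)%:E).
Proof.
move=> c0 phi0 mphi jphi; elim: n c c0 => [|n IH] c c0 //=; split => [p|].
  rewrite (_ : (fun s => _) = (fun s => (c + phi p + \sum_(p <- s) phi p)%:E)).
    by apply: IH; rewrite addr_ge0.
  by apply/funext => s; rewrite big_cons addrA.
rewrite (_ : (fun z => _) = (fun z => (c + phi z + n%:R * J)%:E)).
  by apply/measurable_EFinP; do 2 apply: measurable_funD => //.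
apply/funext => -[a b] /=; rewrite -(@iid_sum _ _ _ phi) ?addr_ge0//.
by congr iid; apply/funext => s; rewrite big_cons addrA.
Qed.

(** The centred number of observations that are at least [t]. *)
Definition dev (t : R) (s : seq (R * R)) : R :=
  \sum_(p <- s) ((t <= p.2)%R%:R - tail F t)%R.

Lemma dev_cons t p s : dev t (p :: s) = ((t <= p.2)%R%:R - tail F t + dev t s)%R.
Proof. by rewrite /dev big_cons. Qed.

Lemma joint_indicator_affine (t a b : R) : (0 <= t)%R -> (0 <= b)%R -> (0 <= a + b)%R ->
  joint F (fun _ x => (a * (t <= x)%R%:R + b)%:E) = (a * tail F t + b)%:E.
Proof.
move=> t0 b0 ab0; case: (leP 0%R a) => a0.
  have -> : (fun _ x : R => (a * (t <= x)%R%:R + b)%:E) =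
      (fun _ x => a%:E * (t <= x)%R%:R%:E + b%:E) by [].
  rewrite jointD//.
  - rewrite jointZ// ?joint_tail ?joint_cst//; exact: measurable_ge_indicator.
  - by move=> *; rewrite -EFinM lee_fin mulr_ge0.
  - by apply: emeasurable_funM => //; exact: measurable_ge_indicator.
(* For negative [a] additivity is used backwards: adding [- a] times the indicator leaves the
   constant [b], and everything stays nonnegative. *)
have fin : joint F (fun _ x => (a * (t <= x)%R%:R + b)%:E) + (- a * tail F t)%:E = b%:E.
  rewrite [X in _ + X](_ : _ = joint F (fun _ x => (- a)%:E * (t <= x)%R%:R%:E)); last first.
    rewrite jointZ ?joint_tail ?oppr_ge0 ?(ltW a0)//.
    exact: measurable_ge_indicator.
  rewrite -jointD//.
  - under eq_fun do under eq_fun do rewrite -EFinM -EFinD mulNr addrAC subrr add0r.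
    exact: joint_cst.
  - by move=> mu x _ _; rewrite lee_fin; case: (t <= x)%R; rewrite ?mulr1// mulr0 add0r.
  - by move=> mu x _ _; rewrite -EFinM lee_fin mulr_ge0// oppr_ge0 ltW.
  - apply/measurable_EFinP; apply: measurable_funD => //; apply: measurable_funM => //.
    by apply/measurable_EFinP; exact: measurable_ge_indicator.
  - by apply: emeasurable_funM => //; exact: measurable_ge_indicator.
move: fin; case: joint => [j| |] //= [] jE; congr EFin.
by rewrite -jE; ring.
Qed.

(** Additivity of variances. The shift [c] absorbs the first observation in the induction; an
    indicator being its own square, the partial expectation that remains is affine in it. *)
Lemma iid_dev2 n (t c eta : R) : (0 <= t)%R -> (0 <= eta)%R ->
  iid F n (fun s => (eta * (c + dev t s) ^+ 2)%:E) =
  (eta * (c ^+ 2 + n%:R * (tail F t * (1 - tail F t))))%:E.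
Proof.
move=> t0 eta0; set g := tail F t; set V := (g * (1 - g))%R.
have V0 : (0 <= V)%R by apply: mulr_ge0; [exact: tail_ge0|rewrite subr_ge0; exact: tail_le1].
elim: n c => [|n IH] c /=.
  by rewrite /dev big_nil addr0 mul0r addr0.
have -> : (fun mu x => iid F n (fun s => (eta * (c + dev t ((mu, x) :: s)) ^+ 2)%:E)) =
    (fun mu x => (eta * (1 + 2 * (c - g)) * (t <= x)%R%:R +
       eta * ((c - g) ^+ 2 + n%:R * V))%:E).
  apply/funext => mu; apply/funext => x.
  rewrite (_ : (fun s => _) =
      fun s => (eta * (c + ((t <= x)%R%:R - g) + dev t s) ^+ 2)%:E); last first.
    by apply/funext => s; rewrite dev_cons addrA.
  by rewrite IH; congr EFin; case: (t <= x)%R => /=; ring.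
have nV : (0 <= n%:R * V)%R by rewrite mulr_ge0.
rewrite joint_indicator_affine//; last 2 first.
- by rewrite mulr_ge0// addr_ge0// sqr_ge0.
- rewrite -mulrDr mulr_ge0//; have := sqr_ge0 (c - g + 1)%R; lra.
by rewrite -natr1 -/g /V; congr EFin; ring.
Qed.

Lemma iid_measurable_dev2 n (t c eta : R) : (0 <= t)%R -> (0 <= eta)%R ->
  iid_measurable n (fun s => (eta * (c + dev t s) ^+ 2)%:E).
Proof.
move=> t0 eta0; elim: n c => [|n IH] c //=; split => [p|].
  rewrite (_ : (fun s => _) =
      fun s => (eta * (c + ((t <= p.2)%R%:R - tail F t) + dev t s) ^+ 2)%:E).
    exact: IH.
  by apply/funext => s; rewrite dev_cons addrA.
rewrite (_ : (fun z => _) = fun z : R * R =>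
    (eta * ((c + ((t <= z.2)%R%:R - tail F t)) ^+ 2 +
       n%:R * (tail F t * (1 - tail F t))))%:E); last first.
  apply/funext => -[a b] /=; rewrite -iid_dev2//.
  by congr iid; apply/funext => s; rewrite dev_cons addrA.
apply/measurable_EFinP; apply: measurable_funM => //; apply: measurable_funD => //.
apply: measurable_funX; apply: measurable_funD => //; apply: measurable_funB => //.
by apply/measurable_EFinP; exact: measurable_ge_indicator.
Qed.

(** Neither [f] nor [g] is measurable in the applications: the measurable error terms are split off
    one at a time by subadditivity, and [g] is what remains. Each squared deviation costs at most
    [eta * n], the variance of an indicator being at most 1. *)
Lemma le_iid_error n f g (phi : R * R -> R) (J eta : R) (ts : seq R) :
  (forall s, sample n s -> 0 <= f s) -> (forall s, sample n s -> 0 <= g s) ->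
  (forall z, 0 <= phi z)%R -> measurable_fun setT phi ->
  joint F (fun mu x => (phi (mu, x))%:E) <= J%:E ->
  (0 <= eta)%R -> all (fun t => 0 <= t)%R ts ->
  (forall s, sample n s -> f s <=
     g s + (\sum_(p <- s) phi p)%:E + (eta * \sum_(t <- ts) dev t s ^+ 2)%:E) ->
  iid F n f <= iid F n g + (n%:R * J + eta * (size ts)%:R * n%:R)%:E.
Proof.
move=> f0 g0 phi0 mphi jphi eta0 ts0 hf.
have j0 : 0 <= joint F (fun mu x => (phi (mu, x))%:E).
  by apply: joint_ge0 => // *; rewrite lee_fin.
have [J' jE J'J] : exists2 J', joint F (fun mu x => (phi (mu, x))%:E) = J'%:E & (J' <= J)%R.
  by move: jphi j0; case: joint => [j| |] //= jJ _; exists j.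
have sphi0 s : (0 <= \sum_(p <- s) phi p)%R by exact: sumr_ge0.
apply: le_trans (le_iid f0 hf) _.
elim: ts ts0 {hf} => [|t ts IH] /= => [_|/andP[t0 ts0]].
  rewrite (_ : (fun s => _) = fun s => g s + (0 + \sum_(p <- s) phi p)%:E); last first.
    by apply/funext => s; rewrite big_nil mulr0 adde0 add0r.
  rewrite mulr0 mul0r addr0; apply: le_trans (iid_lowerD _ _ _) _.
  - exact: iid_measurable_sum jE.
  - by [].
  - by move=> s _; rewrite add0r lee_fin.
  by rewrite (iid_sum n _ _ _ jE)// leeD2l// lee_fin add0r ler_wpM2l.
rewrite (_ : (fun s => _) = fun s =>
    (g s + (\sum_(p <- s) phi p)%:E + (eta * \sum_(t <- ts) dev t s ^+ 2)%:E) +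
    (eta * (0 + dev t s) ^+ 2)%:E); last first.
  apply/funext => s; rewrite big_cons add0r -[RHS]addeA -EFinD -mulrDr.
  by rewrite (addrC (dev t s ^+ 2)%R).
apply: le_trans (iid_lowerD _ _ _) _.
- exact: iid_measurable_dev2.
- move=> s hs; rewrite !adde_ge0 ?g0 ?lee_fin ?mulr_ge0 ?sumr_ge0// => *.
  exact: sqr_ge0.
- by move=> s _; rewrite lee_fin mulr_ge0 ?sqr_ge0.
apply: le_trans (leeD (IH ts0) (lexx _)) _.
rewrite iid_dev2// -addeA leeD2l// -EFinD lee_fin.
have V1 : (eta * (n%:R * (tail F t * (1 - tail F t))) <= eta * n%:R)%R.
  rewrite ler_wpM2l// -[leRHS]mulr1 ler_wpM2l//.
  by have := tail_ge0 hF t0; have := tail_le1 hF t0; nra.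
by rewrite -natr1 expr0n /= add0r; lra.
Qed.

End iid.

(** * Crossings that define the threshold *)

Section threshold.
Context (R : realType) (q : R).
Hypotheses (q_gt0 : 0 < q) (q_lt1 : q < 1).
Implicit Types (G : R -> R) (t a b : R).

Lemma lnq_lt0 : ln q < 0.
Proof. by rewrite ln_lt0// q_gt0. Qed.

Lemma invq_gt1 : 1 < q^-1.
Proof. by rewrite invf_gt1. Qed.

Lemma one_sub_Ecdf t : 0 <= t -> 1 - Ecdf t = expR (- t).
Proof. by move=> t0; rewrite /Ecdf ltNge t0 /= subKr. Qed.

(** The right side is at most 1, while the left side is [1 / q > 1] at negative [t], and exceeds 1
    until [t] reaches [- ln q]. Thresholds thus stay away from 0, where the logarithm is
    singular. *)
Lemma crossing_ge G t : 0 <= G t -> q^-1 * (1 - Ecdf t) <= 1 - G t ->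
  - ln q <= t /\ q^-1 * expR (- t) <= 1 - G t.
Proof.
move=> G0; have := invq_gt1 => q1; case: (ltP t 0) => t0.
  by rewrite /Ecdf t0; lra.
rewrite one_sub_Ecdf// => h; split => //.
have : expR (- t) <= q by rewrite -(@ler_pM2l _ q^-1) ?invr_gt0// mulVf ?gt_eqF//; lra.
by rewrite -{1}(lnK (x := q)) ?posrE// ler_expR; lra.
Qed.

Lemma Tq_ge G a : (forall t, 0 <= G t) ->
  (forall t, - ln q <= t -> t < a -> 1 - G t < q^-1 * expR (- t)) ->
  (a%:E <= Tq q G)%E.
Proof.
move=> G0 Ga; apply: le_ereal_inf_tmp => _ [t /= tS <-]; rewrite lee_fin leNgt.
apply/negP => ta; have [t0 ht] := crossing_ge (G0 t) tS.
by have := Ga t t0 ta; rewrite ltNge ht.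
Qed.

Lemma Tq_ge_lnq G : (forall t, 0 <= G t) -> ((- ln q)%:E <= Tq q G)%E.
Proof. by move=> G0; apply: Tq_ge => // t h1 h2; lra. Qed.

Lemma Tq_le G t : 0 <= t -> q^-1 * expR (- t) <= 1 - G t -> (Tq q G <= t%:E)%E.
Proof.
move=> t0 h; apply: ereal_inf_lbound; exists t => //=.
by rewrite one_sub_Ecdf.
Qed.

Lemma lt_Tq G t : 0 <= t -> (t%:E < Tq q G)%E -> 1 - G t < q^-1 * expR (- t).
Proof.
by move=> t0; rewrite ltNge => /negP h; rewrite ltNge; apply/negP => /(Tq_le t0).
Qed.

Lemma Tq_lt G t : (forall t, 0 <= G t) -> (Tq q G < t%:E)%E ->
  exists u, [/\ - ln q <= u, u < t & q^-1 * expR (- u) <= 1 - G u].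
Proof.
move=> G0 /ereal_inf_lt[_ [u /= uS <-]]; rewrite lte_fin => ut.
by have [? ?] := crossing_ge (G0 u) uS; exists u.
Qed.

Section empirical.
Variables (n : nat) (s : seq (R * R)).
Hypotheses (n_gt0 : (0 < n)%N) (sn : size s = n).

Lemma Gn_ge0 t : 0 <= Gn s t.
Proof. by rewrite /Gn divr_ge0. Qed.

Lemma one_sub_Gn t : 1 - Gn s t = (count (fun p : R * R => t <= p.2) s)%:R / n%:R.
Proof.
have n0 : n%:R != 0 :> R by rewrite pnatr_eq0 -lt0n.
rewrite /Gn sn -[X in X - _](divff n0) -mulrBl size_filter -{1}sn.
rewrite -(count_predC (fun p : R * R => p.2 < t)) natrD addrAC subrr add0r.
by congr (_%:R / _); apply: eq_count => p /=; rewrite leNgt.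
Qed.

Lemma one_sub_Gn_nincr t u : t <= u -> 1 - Gn s u <= 1 - Gn s t.
Proof.
move=> tu; rewrite !one_sub_Gn ler_pM2r ?invr_gt0 ?ltr0n// ler_nat.
by apply: sub_count => p /=; exact: le_trans.
Qed.

(** Covers both the finite infimum and the fallback value. The condition [a <= ln (n / q)] in the
    lower bound is what the fallback requires; the upper bound is vacuous in that case, since a
    crossing at [b] would make the infimum finite. *)
Lemma That_fin : exists tau, [/\ That q n s = tau%:E, - ln q <= tau,
  tau <= ln (n%:R / q),
  forall a, a <= ln (n%:R / q) ->
    (forall t, - ln q <= t -> t < a -> 1 - Gn s t < q^-1 * expR (- t)) -> a <= tau &
  forall b, 0 <= b -> q^-1 * expR (- b) <= 1 - Gn s b -> tau <= b].
Proof.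
have nR : 1 <= n%:R :> R by rewrite ler1n.
have lnq0 := lnq_lt0.
have ln0 : - ln q <= ln (n%:R / q).
  rewrite ln_div ?posrE//; last by lra.
  by have := ln_ge0 nR; lra.
have := Tq_ge_lnq Gn_ge0; rewrite /That; case E : (Tq q (Gn s)) => [r| |] //=.
  rewrite lee_fin => r0; exists r; split => //.
  - rewrite -lee_fin -E; have [u [u0 _ hu]] : exists u, [/\ - ln q <= u, u < r + 1
        & q^-1 * expR (- u) <= 1 - Gn s u].
      by apply: Tq_lt => //; [exact: Gn_ge0|rewrite E lte_fin; lra].
    case: (leP u (ln (n%:R / q))) => hun.
      by apply: le_trans (Tq_le _ hu) _; rewrite ?lee_fin//; lra.
    (* At [ln (n / q)] the level to be reached is exactly [1 / n]. A later crossing at [u] makes the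
       empirical tail positive there, hence at least [1 / n], so the crossing has already
       occurred. *)
    apply: Tq_le; first by lra.
    rewrite expRN lnK ?posrE ?divr_gt0 ?ltr0n// invf_div mulrA mulVf ?gt_eqF//.
    apply: le_trans (one_sub_Gn_nincr (ltW hun)); move: hu.
    rewrite one_sub_Gn ler_pM2r ?invr_gt0 ?ltr0n// ler1n lt0n => hu.
    apply/negP => /eqP c0; move: hu; rewrite c0 mul0r leNgt => /negP; apply.
    by rewrite mulr_gt0 ?expR_gt0 ?invr_gt0.
  - by move=> a an ha; rewrite -lee_fin -E; apply: Tq_ge => //; exact: Gn_ge0.
  - by move=> b b0 hb; rewrite -lee_fin -E; exact: Tq_le.
move=> _; exists (ln (n%:R / q)); split => // b b0 hb.
by have := Tq_le b0 hb; rewrite E.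
Qed.

End empirical.
End threshold.

(** * Convexity of the tilted tail and the margin around the crossing *)

Section crossing.
Context (R : realType) (q : R) (F : probability R R).
Hypotheses (q_gt0 : 0 < q) (q_lt1 : q < 1) (hF : F \in @priors R).
Local Notation T := (Tq q (mixcdf F)).
Local Notation H t := (expR t * tail F t).

(** The tangent to [expR] at [th * y] lies below the graph at 0 and at [y]; the average of these two
    inequalities with weights [1 - th] and [th] eliminates the slope. *)
Lemma expR_weighted_AMGM (th y : R) : 0 <= th -> th <= 1 ->
  expR (th * y) <= (1 - th) + th * expR y.
Proof.
move=> th0 th1; set c := expR (th * y); have c0 : 0 < c by exact: expR_gt0.
have h1 : c * (1 - th * y) <= 1.
  have := expR_ge1Dx (- (th * y)) => h; have := ler_wpM2l (ltW c0) h.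
  by rewrite -expRD subrr expR0.
have h2 : c * (1 + (1 - th) * y) <= expR y.
  have := ler_wpM2l (ltW c0) (expR_ge1Dx ((1 - th) * y)); rewrite -expRD.
  by rewrite (_ : th * y + (1 - th) * y = y)//; ring.
have th1' : 0 <= 1 - th by lra.
have := ler_wpM2l th1' h1; have := ler_wpM2l th0 h2; lra.
Qed.

Lemma integral_expR_tail (t : R) : 0 <= t ->
  (\int[F]_(mu in `[1%R, +oo[) (expR (t * (1 - mu^-1)))%:E = (H t)%:E)%E.
Proof.
move=> t0; rewrite EFinM -integral_tail// -ge0_integralZl_EFin ?expR_ge0//.
- apply: eq_integral => mu _; rewrite -EFinM -expRD; congr (expR _)%:E; ring.
- exact: measurable_expdiv.
Qed.

Lemma tail_convex (s t : R) : 0 <= s -> s <= t -> 0 < t ->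
  H s <= 1 + s / t * (H t - 1).
Proof.
move=> s0 st t0; set th := s / t.
have th0 : 0 <= th by rewrite divr_ge0// ltW.
have th1 : th <= 1 by rewrite ler_pdivrMr// mul1r.
rewrite (_ : 1 + _ = (1 - th) + th * H t); last by ring.
rewrite -lee_fin EFinD (EFinM th) -(integral_expR_tail s0) -(integral_expR_tail (ltW t0)).
have mE (u : R) : measurable_fun (`[1%R, +oo[%classic : set R) (fun mu : R => (expR (u * (1 - mu^-1)))%:E).
  apply/measurable_EFinP; apply: measurable_funTS; apply: measurableT_comp => //.
  apply: measurable_funM => //; apply: measurable_funB => //; exact: measurable_invr.
have -> : ((1 - th)%:E = \int[F]_(mu in `[1%R, +oo[) (cst (1 - th)%:E mu))%E.
  by rewrite integral_cst// -[LHS]mule1; congr (_ * _)%E; exact/esym/prior_itv.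
rewrite -ge0_integralZl_EFin// -ge0_integralD//.
- apply: le_integral_lower_in => // mu _.
  rewrite lee_fin; apply: le_trans (expR_weighted_AMGM _ th0 th1).
  by rewrite /th mulrA divfK ?gt_eqF.
- by move=> mu _; rewrite lee_fin subr_ge0.
- by move=> mu _; rewrite -EFinM lee_fin mulr_ge0 ?expR_ge0.
- by apply: emeasurable_funM.
Qed.

Lemma mixcdf_ge0 (t : R) : 0 <= mixcdf F t.
Proof.
rewrite /mixcdf fine_ge0//; apply: integral_ge0 => mu _; rewrite lee_fin /Ecdf.
by case: ltP => // h; rewrite subr_ge0 -expR0 ler_expR; lra.
Qed.

Lemma tail_below (t : R) : 0 <= t -> (t%:E < T)%E -> H t < q^-1.
Proof.
move=> t0 /(lt_Tq t0); rewrite -/(tail F t) => h.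
by rewrite -(ltr_pM2l (expR_gt0 (- t))) mulrA -expRD addNr expR0 mul1r mulrC.
Qed.

Lemma tail_above (u : R) : q^-1 * expR (- u) <= 1 - mixcdf F u -> q^-1 <= H u.
Proof.
move=> h.
by rewrite -(ler_pM2l (expR_gt0 (- u))) mulrA -expRD addNr expR0 mul1r mulrC.
Qed.

(* Convexity of [H] makes the crossing of the level [1/q] transversal, uniformly in the prior. *)
Lemma tail_gap_below (T0 d t : R) : 0 < T0 -> (T0%:E <= T)%E -> 0 < d -> d <= 1 ->
  0 <= t -> t <= (1 - d) * T0 -> H t <= q^-1 - d / 2 * (q^-1 - 1).
Proof.
move=> T00 T0T d0 d1 t0 tT.
have q1 := invq_gt1 q_gt0 q_lt1.
(* [T0] may itself be the crossing, so the strict inequality is read at [u]. The ratio [t / u] is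
   then at most [(1 - d) / (1 - d / 2)], which is at most [1 - d / 2]. *)
pose u := (1 - d / 2) * T0.
have u0 : 0 < u by rewrite /u mulr_gt0//; lra.
have tu : t <= u by rewrite /u; nra.
have uT : (u%:E < T)%E by apply: lt_le_trans T0T; rewrite lte_fin /u; nra.
have Hu := tail_below (ltW u0) uT.
have tu1 : t / u <= 1 - d / 2 by rewrite ler_pdivrMr// /u; nra.
have tu0 : 0 <= t / u by rewrite divr_ge0// ltW.
have c1 : 0 <= q^-1 - 1 by rewrite subr_ge0 ltW.
apply: le_trans (tail_convex t0 tu u0) _.
rewrite (_ : q^-1 - _ = 1 + (1 - d / 2) * (q^-1 - 1)); last by ring.
rewrite lerD2l; apply: (@le_trans _ _ (t / u * (q^-1 - 1))).
  by rewrite ler_wpM2l// lerD2r ltW.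
by rewrite ler_wpM2r.
Qed.

(** A crossing [u] is taken within a factor [1 + d / 2] of the infimum, so no continuity is used.
    Convexity carries the excess over 1 from [u] to [b = (1 + d) * T1], multiplied by at least
    [(1 + d) / (1 + d / 2) >= 1 + d / 4]. *)
Lemma tail_gap_above (T1 d : R) : T = T1%:E -> 0 < d -> d <= 1 ->
  q^-1 + d / 4 * (q^-1 - 1) <= H ((1 + d) * T1).
Proof.
move=> TT d0 d1; have q1 := invq_gt1 q_gt0 q_lt1.
have T1q : - ln q <= T1 by have := Tq_ge_lnq q_gt0 q_lt1 mixcdf_ge0; rewrite TT lee_fin.
have lnq0 := lnq_lt0 q_gt0 q_lt1.
have [u [u0 uT hu]] : exists u, [/\ - ln q <= u, u < (1 + d / 2) * T1
    & q^-1 * expR (- u) <= 1 - mixcdf F u].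
  by apply: Tq_lt => //; [exact: mixcdf_ge0|rewrite TT lte_fin; nra].
have Hu := tail_above hu; set b := (1 + d) * T1.
have b0 : 0 < b by rewrite /b; nra.
have ub : u <= b by rewrite /b; nra.
clear TT; have u00 : 0 <= u by lra.
have := tail_convex u00 ub b0.
have ub1 : u / b <= (1 + d / 2) / (1 + d).
  rewrite ler_pdivrMr// /b mulrA divfK ?ltW// gt_eqF//; lra.
have ub2 : (1 + d / 2) / (1 + d) * (1 + d / 4) <= 1.
  by rewrite mulrAC ler_pdivrMr; [nra|lra].
have ub0 : 0 < u / b by rewrite divr_gt0//; lra.
set v := u / b in ub1 ub0 *; have vd : v * (1 + d / 4) <= 1.
  apply: le_trans ub2; rewrite ler_pM2r//; lra.
move=> h; have c1 : 0 <= q^-1 - 1 by rewrite subr_ge0 ltW.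
have h2 : q^-1 - 1 <= v * (H b - 1) by rewrite lerBlDl (le_trans Hu).
have h3 : v * ((1 + d / 4) * (q^-1 - 1)) <= v * (H b - 1).
  by apply: le_trans h2; rewrite mulrA -[leRHS]mul1r ler_wpM2r.
rewrite (_ : _ + _ = (1 + d / 4) * (q^-1 - 1) + 1); last by ring.
by rewrite -lerBrDr -(ler_pM2l ub0).
Qed.

End crossing.

(** * Losses and their pointwise bounds *)

Section losses.
Context (R : realType).
Implicit Types (z : R * R) (a b mu x t : R).

Definition loss (t : \bar R) (z : R * R) : R := (ln (delta t z.2) - ln z.1) ^+ 2.

(* Losses incurred below [b] without, and above [a] with, thresholding; for [k = 2] their sum dominates the loss of every threshold in [[a, b]]. *)
Definition below (k : nat) b z : R := (z.2 < b)%R%:R * ln z.1 ^+ k.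
Definition above (k : nat) a z : R := (a <= z.2)%R%:R * (ln z.2 - ln z.1) ^+ k.
Definition between a b z : R :=
  (a <= z.2 < b)%R%:R * (ln z.1 ^+ 2 + (ln z.2 - ln z.1) ^+ 2).

Lemma loss_ge0 (t : \bar R) z : 0 <= loss t z. Proof. exact: sqr_ge0. Qed.

Lemma lossE t z : loss t%:E z =
  if t <= z.2 then (ln z.2 - ln z.1) ^+ 2 else ln z.1 ^+ 2.
Proof. by rewrite /loss /=; case: ifP => // _; rewrite ln1 sub0r sqrrN. Qed.

Lemma below_ge0 k b z : ~~ odd k -> 0 <= below k b z.
Proof. by move=> k2; rewrite mulr_ge0// exprn_even_ge0. Qed.

Lemma above_ge0 k a z : ~~ odd k -> 0 <= above k a z.
Proof. by move=> k2; rewrite mulr_ge0// exprn_even_ge0. Qed.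

Lemma between_ge0 a b z : 0 <= between a b z.
Proof. by rewrite mulr_ge0// addr_ge0// sqr_ge0. Qed.

Lemma loss_le t a b z : a <= t -> t <= b ->
  loss t%:E z <= below 2 b z + above 2 a z.
Proof.
move=> at_ tb; rewrite lossE /below /above.
have s1 := sqr_ge0 (ln z.1); have s2 := sqr_ge0 (ln z.2 - ln z.1).
case: (leP t z.2) => tz.
  by rewrite (le_trans at_ tz) mul1r lerDr mulr_ge0.
by rewrite (lt_le_trans tz tb) mul1r lerDl mulr_ge0.
Qed.

(** Two thresholds treat an observation differently only if it lies between them. The error is
    symmetric in [t] and [u], so it serves both directions of the comparison. *)
Lemma loss_diff t u a b z : a <= t -> t <= b -> a <= u -> u <= b ->
  loss t%:E z <= loss u%:E z + between a b z.
Proof.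
move=> at_ tb au ub; rewrite !lossE /between.
have s1 := sqr_ge0 (ln z.1); have s2 := sqr_ge0 (ln z.2 - ln z.1).
case: (leP t z.2) => tz; case: (leP u z.2) => uz.
- by rewrite lerDl mulr_ge0// addr_ge0.
- by rewrite (le_trans at_ tz) (lt_le_trans uz ub) /=; lra.
- by rewrite (le_trans au uz) (lt_le_trans tz tb) /=; lra.
- by rewrite lerDl mulr_ge0// addr_ge0.
Qed.

Lemma sqr_below_above a b z :
  (below 2 b z + above 2 a z) ^+ 2 <= 2 * (below 4 b z + above 4 a z).
Proof.
rewrite /below /above; set u := ln z.1; set v := ln z.2 - ln z.1.
have e4 (y : R) : y ^+ 4 = (y ^+ 2) ^+ 2 by rewrite -exprM.
rewrite !e4; move: (u ^+ 2) (v ^+ 2) => U V; have := sqr_ge0 (U - V).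
have := sqr_ge0 U; have := sqr_ge0 V.
by case: (z.2 < b); case: (a <= z.2); rewrite /= ?mul1r ?mul0r ?addr0 ?add0r; nra.
Qed.

Lemma measurable_ln1 : measurable_fun setT (fun z : R * R => ln z.1).
Proof. by apply: measurableT_comp => //; exact: measurable_ln. Qed.

Lemma measurable_ln2 : measurable_fun setT (fun z : R * R => ln z.2).
Proof. by apply: measurableT_comp => //; exact: measurable_ln. Qed.

Lemma measurable_ind (P : R -> bool) : measurable_fun setT P ->
  measurable_fun setT (fun z : R * R => (P z.2)%:R : R).
Proof.
move=> mP; apply: (measurableT_comp (f := fun b : bool => b%:R : R)) => //.
exact: measurableT_comp.
Qed.

Lemma measurable_below k b : measurable_fun setT (below k b).
Proof.
apply: measurable_funM; last by apply: measurable_funX; exact: measurable_ln1.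
by apply: (@measurable_ind (fun x => x < b)); exact: measurable_fun_ltr.
Qed.

Lemma measurable_above k a : measurable_fun setT (above k a).
Proof.
apply: measurable_funM.
  by apply: (@measurable_ind (fun x => a <= x)); exact: measurable_fun_ler.
apply: measurable_funX; apply: measurable_funB; [exact: measurable_ln2|exact: measurable_ln1].
Qed.

Lemma measurable_between a b : measurable_fun setT (between a b).
Proof.
apply: measurable_funM.
  apply: (@measurable_ind (fun x => (a <= x) && (x < b))).
  by apply: measurable_and; [exact: measurable_fun_ler|exact: measurable_fun_ltr].
apply: measurable_funD; apply: measurable_funX; first exact: measurable_ln1.
by apply: measurable_funB; [exact: measurable_ln2|exact: measurable_ln1].
Qed.

Lemma measurable_loss (t : \bar R) : measurable_fun setT (loss t).
Proof.
apply: measurable_funX; apply: measurable_funB; last exact: measurable_ln1.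
apply: measurableT_comp; first exact: measurable_ln.
case: t => [t| |].
- apply: (@measurable_fun_ifT _ _ _ _ (fun z : R * R => z.2) (cst 1)
    (fun z : R * R => t <= z.2)) => //.
    by apply: (measurableT_comp (f := fun x => t <= x)) => //; exact: measurable_fun_ler.
  by rewrite (_ : [eta snd] = snd).
- exact: measurable_cst.
- by rewrite (_ : (fun x : R * R => delta -oo x.2) = snd).
Qed.

(** With [w] the square root of [mu], [ln mu = 2 * ln w <= 2 * (w - 1) <= 2 * (w - w^-1)], and
    [w - w^-1 = w * (1 - mu^-1)]. The factor [mu] is later cancelled by the density. *)
Lemma ln_sqr_le mu : 1 <= mu -> ln mu ^+ 2 <= mu * (2 * (1 - mu^-1)) ^+ 2.
Proof.
move=> mu1; have l0 := ln_ge0 mu1; pose w := expR (ln mu / 2).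
have w1 : 1 <= w by rewrite -expR0 ler_expR; lra.
have wE : w ^+ 2 = mu.
  by rewrite /w -expRM_natl mulrCA divff// mulr1 lnK// posrE; lra.
have lw : ln mu <= 2 * (w - 1) by have := expR_ge1Dx (ln mu / 2); rewrite -/w; lra.
apply: (@le_trans _ _ ((2 * (w - 1)) ^+ 2)).
  by rewrite lerXn2r ?nnegrE//; lra.
have e : mu * (2 * (1 - mu^-1)) ^+ 2 = (2 * ((w - 1) * (1 + w^-1))) ^+ 2.
  by rewrite -wE; field; rewrite gt_eqF//; lra.
have wi : 0 <= w^-1 by rewrite invr_ge0; lra.
rewrite e lerXn2r ?nnegrE//.
- by lra.
- by rewrite mulr_ge0// mulr_ge0//; lra.
rewrite ler_pM2l// -[leLHS]mulr1 ler_wpM2l//; lra.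
Qed.

Lemma dens_le mu x : 1 <= mu -> 0 < x -> dens mu x <= mu^-1.
Proof.
move=> mu1 x0; rewrite /dens -[leRHS]mulr1 ler_wpM2l ?invr_ge0//; first by lra.
by rewrite -expR0 ler_expR oppr_le0 divr_ge0//; lra.
Qed.

Lemma ln_sqr_dens mu x : 1 <= mu -> 0 < x ->
  ln mu ^+ 2 * dens mu x <= (2 * (1 - mu^-1)) ^+ 2.
Proof.
move=> mu1 x0; have mu0 : 0 < mu by lra.
apply: (@le_trans _ _ (mu * (2 * (1 - mu^-1)) ^+ 2 * mu^-1)).
  by apply: ler_pM; rewrite ?sqr_ge0 ?dens_ge0 ?dens_le ?ln_sqr_le.
by rewrite mulrAC divff ?mul1r// gt_eqF.
Qed.

Lemma ln_pow4_dens mu x : 1 <= mu -> 0 < x -> ln mu ^+ 4 * dens mu x <= 8 ^+ 4.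
Proof.
move=> mu1 x0; have mu0 : 0 < mu by lra.
have l0 := ln_ge0 mu1.
apply: (@le_trans _ _ (8 ^+ 4 * mu * mu^-1)); last by rewrite mulfK// gt_eqF.
apply: ler_pM; rewrite ?exprn_ge0 ?dens_ge0 ?dens_le//.
apply: le_trans (expR_ge_pow4 _) _; rewrite ler_pM2l ?exprn_gt0//.
by rewrite ger0_norm// -[leRHS]lnK ?posrE// ler_expR; lra.
Qed.

End losses.

(** * Moments of the losses, uniform in the prior *)

Section joint_bounds.
Context (R : realType) (F : probability R R).
Hypothesis hF : F \in @priors R.
Local Notation J phi := (joint F (fun mu x => (phi (mu, x))%:E)).
Local Notation itv1y := (`[1%R, +oo[%classic : set R).
Implicit Types (phi f g : R * R -> R) (a b c : R).

Lemma measurable_uncurry phi : measurable_fun setT phi ->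
  measurable_fun setT (fun z : R * R => (phi (z.1, z.2))%:E).
Proof.
move=> mphi; apply/measurable_EFinP; apply: eq_measurable_fun mphi.
by move=> [a b] _.
Qed.

Lemma joint_leD f g (A B : R) : (forall z, 0 <= f z) -> (forall z, 0 <= g z) ->
  measurable_fun setT g -> (J f <= A%:E)%E -> (J g <= B%:E)%E ->
  (J (fun z => f z + g z)%R <= (A + B)%:E)%E.
Proof.
move=> f0 g0 mg fA gB; rewrite EFinD; apply: le_trans (leeD fA gB).
apply: (joint_lowerD (f := fun mu x => (f (mu, x))%:E)
  (g := fun mu x => (g (mu, x))%:E) hF) => [mu x _ _|mu x _ _|].
- by rewrite lee_fin.
- by rewrite lee_fin.
- exact: measurable_uncurry.
Qed.

Lemma joint_leZ f (k A : R) : 0 <= k -> (forall z, 0 <= f z) ->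
  measurable_fun setT f -> (J f <= A%:E)%E ->
  (J (fun z => k * f z)%R <= (k * A)%:E)%E.
Proof.
move=> k0 f0 mf fA.
rewrite (jointZ (f := fun mu x => (f (mu, x))%:E) hF) //.
- by rewrite EFinM lee_wpmul2l ?lee_fin.
- by move=> mu x _ _; rewrite lee_fin.
- exact: measurable_uncurry.
Qed.

Lemma joint_le_integral f (h : R -> R) : (forall z, 0 <= f z) ->
  (forall mu, 1 <= mu ->
    (\int[@lebesgue_measure R]_(x in `]0%R, +oo[) ((f (mu, x))%:E * (dens mu x)%:E) <= (h mu)%:E)%E) ->
  (J f <= \int[F]_(mu in itv1y) (h mu)%:E)%E.
Proof.
move=> f0 fh.
apply: (joint_le_inner (f := fun mu x => (f (mu, x))%:E) (h := fun mu => (h mu)%:E) hF) => //.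
by move=> *; rewrite lee_fin.
Qed.

Lemma joint_le_cst f c : 0 <= c -> (forall z, 0 <= f z) ->
  (forall mu, 1 <= mu ->
    (\int[@lebesgue_measure R]_(x in `]0%R, +oo[) ((f (mu, x))%:E * (dens mu x)%:E) <= c%:E)%E) ->
  (J f <= c%:E)%E.
Proof.
move=> c0 f0 fc; apply: le_trans (joint_le_integral f0 fc) _.
rewrite integral_cst//=.
by rewrite -[leRHS]mule1 lee_wpmul2l ?lee_fin//; exact: probability_le1.
Qed.

Lemma inner_below k b mu (M : R) : 0 <= b -> 1 <= mu -> 0 <= M -> ~~ odd k ->
  (forall x, 0 < x -> ln mu ^+ k * dens mu x <= M) ->
  (\int[@lebesgue_measure R]_(x in `]0%R, +oo[)
     ((below k b (mu, x))%:E * (dens mu x)%:E) <= (M * b)%:E)%E.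
Proof.
move=> b0 mu1 M0 k2 kM; rewrite -{2}(subr0 b).
pose g x := (0 <= x < b)%R%:R * ln mu ^+ k.
rewrite [leLHS](_ : _ = (\int[@lebesgue_measure R]_(x in `]0%R, +oo[)
    ((g x)%:E * (dens mu x)%:E))%E); last first.
  apply: eq_integral => x; rewrite in_oy => x0.
  by rewrite /g /below /= (ltW x0).
apply: inner_itv_le => //.
- by move=> x; rewrite mulr_ge0// exprn_even_ge0.
- by move=> x; rewrite /g => /negbTE ->; rewrite mul0r.
- by move=> x x0 _ xb; rewrite /g (ltW x0) xb mul1r; exact: kM.
Qed.

Lemma joint_below4 b : 0 <= b -> (J (below 4 b) <= (8 ^+ 4 * b)%:E)%E.
Proof.
move=> b0; apply: joint_le_cst => [|z|mu mu1].
- by rewrite mulr_ge0 ?exprn_ge0.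
- exact: below_ge0.
by apply: inner_below => // x x0; exact: ln_pow4_dens.
Qed.

Lemma inner_above k a mu (c e : R) : 0 < a -> 1 <= mu -> 0 <= c -> ~~ odd k ->
  (forall z : R, z ^+ k <= c * expR (`|z| / 2)) ->
  expR (- (a / mu / 2)) <= e ->
  (\int[@lebesgue_measure R]_(x in `]0%R, +oo[)
     ((above k a (mu, x))%:E * (dens mu x)%:E) <= (64 * c * e)%:E)%E.
Proof.
move=> a0 mu1 c0 k2 kc ee; have mu0 : 0 < mu by lra.
have e0 : 0 <= e by apply: le_trans ee; exact: expR_ge0.
apply: (@inner_tail_le _ mu a _ (fun x => above k a (mu, x))) => //.
- by rewrite !mulr_ge0.
- by move=> x; exact: above_ge0.
- by move=> x xa; rewrite /above /= leNgt xa mul0r.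
move=> x ax; have x0 : 0 < x by exact: lt_le_trans ax.
rewrite /above /= ax mul1r; apply: le_trans (log_dens_le_psi mu1 x0 c0 (kc _)) _.
rewrite ler_wpM2r ?psi_ge0// ler_wpM2l ?mulr_ge0//.
apply: le_trans ee; rewrite ler_expR lerN2 ler_pM2r ?invr_gt0//.
by rewrite ler_pM2r ?invr_gt0.
Qed.

Lemma joint_above4 a : 0 < a -> (J (above 4 a) <= (64 * 8 ^+ 4)%:E)%E.
Proof.
move=> a0; apply: joint_le_cst => [|z|mu mu1].
- by rewrite mulr_ge0 ?exprn_ge0.
- exact: above_ge0.
rewrite -[X in X%:E]mulr1; apply: inner_above => //.
- exact: expR_ge_pow4.
- by rewrite -expR0 ler_expR oppr_le0 !divr_ge0//; lra.
Qed.

(** The integrand is at most [3 * ln mu ^+ 2 + 2 * ln x ^+ 2] times the density; the first square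
    times the density is at most 4, and the second is at most [c ^+ 2]. *)
Lemma joint_between a b c : 0 < a -> a <= b -> ln b <= c -> - ln a <= c -> 0 <= c ->
  (J (between a b) <= ((12 + 2 * c ^+ 2) * (b - a))%:E)%E.
Proof.
move=> a0 ab bc ac c0.
have M0 : 0 <= 12 + 2 * c ^+ 2 by have := sqr_ge0 c; lra.
apply: joint_le_cst => [|z|mu mu1].
- by rewrite mulr_ge0// subr_ge0.
- exact: between_ge0.
apply: (@inner_itv_le _ mu a b _ (fun x => between a b (mu, x))) => //.
- exact: ltW.
- by move=> x; exact: between_ge0.
- by move=> x; rewrite /between /= => /negbTE ->; rewrite mul0r.
move=> x x0 ax xb; rewrite /between /= ax xb mul1r.
have mu0 : 0 < mu by lra.
have d0 := dens_ge0 x mu1.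
have lx : ln x ^+ 2 <= c ^+ 2.
  have l1 : ln a <= ln x by rewrite ler_ln ?posrE.
  have l2 : ln x <= ln b by rewrite ler_ln ?posrE ?(lt_le_trans a0)// ltW.
  nra.
have d1 : dens mu x <= 1.
  by apply: le_trans (dens_le mu1 x0) _; rewrite invf_le1.
have l1 : ln mu ^+ 2 * dens mu x <= 4.
  apply: le_trans (ln_sqr_dens mu1 x0) _.
  have i0 : 0 <= mu^-1 by rewrite invr_ge0; lra.
  have i1 : mu^-1 <= 1 by rewrite invf_le1.
  nra.
have l2 : (ln x - ln mu) ^+ 2 <= 2 * ln x ^+ 2 + 2 * ln mu ^+ 2.
  by have := sqr_ge0 (ln x + ln mu); nra.
have := ler_wpM2r d0 l2; have := ler_wpM2r d0 lx; have := sqr_ge0 c; nra.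
Qed.

Lemma sqr_le_expR (y : R) : 0 <= y -> y ^+ 2 <= 4 * expR y.
Proof.
move=> y0; have := expR_ge1Dx (y / 2) => h.
have -> : expR y = expR (y / 2) ^+ 2 by rewrite -expRM_natl mulrCA divff// mulr1.
nra.
Qed.

Lemma measurable_expR_scaled (t : R) (D : set R) :
  measurable_fun D (fun mu : R => (expR (t * (1 - mu^-1)))%:E).
Proof.
apply/measurable_EFinP; apply: measurable_funTS; apply: measurableT_comp => //.
apply: measurable_funM => //; apply: measurable_funB => //; exact: measurable_invr.
Qed.

(** The weight [expR (t * (1 - mu^-1))] integrates to [H t], so knowing [H] at a single point before
    the crossing controls how far the prior is from the point mass at 1. *)
Lemma joint_le_tail f (k t l : R) : 0 <= k -> 0 <= t -> (forall z, 0 <= f z) ->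
  expR t * tail F t <= l ->
  (forall mu, 1 <= mu ->
    (\int[@lebesgue_measure R]_(x in `]0%R, +oo[) ((f (mu, x))%:E * (dens mu x)%:E) <=
     (k * expR (t * (1 - mu^-1)))%:E)%E) ->
  (J f <= (k * l)%:E)%E.
Proof.
move=> k0 t0 f0 tl fk.
apply: le_trans (joint_le_integral f0 fk) _.
under eq_integral do rewrite EFinM.
rewrite ge0_integralZl_EFin//; last exact: measurable_expR_scaled.
by rewrite (integral_expR_tail hF)// -EFinM lee_fin ler_wpM2l.
Qed.

Lemma joint_below_tail b t l : 0 <= b -> 0 < t -> expR t * tail F t <= l ->
  (J (below 2 b) <= (16 * b / t ^+ 2 * l)%:E)%E.
Proof.
move=> b0 t0 tl; apply: (@joint_le_tail _ _ t) => //.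
- by rewrite !mulr_ge0 ?invr_ge0 ?sqr_ge0.
- exact: ltW.
- by move=> z; exact: below_ge0.
move=> mu mu1.
apply: le_trans (@inner_below 2 b mu ((2 * (1 - mu^-1)) ^+ 2) b0 mu1 _ _ _) _ => //.
- exact: sqr_ge0.
- by move=> x x0; exact: ln_sqr_dens.
rewrite lee_fin; have i1 : mu^-1 <= 1 by rewrite invf_le1//; lra.
have := @sqr_le_expR (t * (1 - mu^-1)).
rewrite mulr_ge0 ?subr_ge0 ?(ltW t0)// => /(_ isT) h.
have {}h : (1 - mu^-1) ^+ 2 <= 4 * expR (t * (1 - mu^-1)) / t ^+ 2.
  by rewrite ler_pdivlMr ?exprn_gt0// mulrC -exprMn.
have -> : (2 * (1 - mu^-1)) ^+ 2 * b = 4 * b * (1 - mu^-1) ^+ 2 by ring.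
have b4 : 0 <= 4 * b by lra.
by have := ler_wpM2l b4 h; lra.
Qed.

Lemma joint_above_tail a t l : 0 < a -> a <= t -> expR t * tail F t <= l ->
  (J (above 2 a) <= (64 * 8 ^+ 2 * expR (- (a / 4)) * l)%:E)%E.
Proof.
move=> a0 at_ tl; apply: (@joint_le_tail _ _ t) => //.
- by lra.
- by move=> z; exact: above_ge0.
move=> mu mu1; rewrite -[X in X%:E]mulrA; apply: inner_above => //.
- exact: expR_ge_pow2.
(* [- a / (2 * mu)] equals [- a / 2 + a / 2 * (1 - mu^-1)]: means near 1 give exponential decay in
   [a], and large means are charged to the weight. *)
rewrite -expRD ler_expR.
have i1 : mu^-1 <= 1 by rewrite invf_le1//; lra.
have h : a * (1 - mu^-1) <= t * (1 - mu^-1) by rewrite ler_wpM2r// subr_ge0.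
nra.
Qed.

End joint_bounds.

(** * Concentration at finitely many points *)

Section good_event.
Context (R : realType) (q : R) (F : probability R R).
Hypotheses (q_gt0 : 0 < q) (q_lt1 : q < 1) (hF : F \in @priors R).
Local Notation J phi := (joint F (fun mu x => (phi (mu, x))%:E)).
Implicit Types (s : seq (R * R)) (n : nat).

Lemma devE n s t : sample n s ->
  dev F t s = (count (fun p : R * R => t <= p.2) s)%:R - n%:R * tail F t.
Proof.
move=> /andP[/eqP <- _]; elim: s => [|p s IH] /=.
  by rewrite /dev big_nil mul0r subr0.
by rewrite dev_cons IH natrD -[in RHS]natr1; lra.
Qed.

Lemma one_sub_Gn_dev n s t : (0 < n)%N -> sample n s ->
  1 - Gn s t = tail F t + dev F t s / n%:R.
Proof.
move=> n0 hs; have /andP[/eqP sn _] := hs.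
rewrite (one_sub_Gn n0 sn) (devE _ hs) mulrBl mulrAC divff ?mul1r; last first.
  by rewrite pnatr_eq0 -lt0n.
by rewrite addrC subrK.
Qed.

(** Pointwise form of Chebyshev's inequality with a union bound. *)
Lemma dev_dichotomy (ts : seq R) s (m : R) : 0 <= m ->
  (forall t, t \in ts -> `|dev F t s| < m) \/ m ^+ 2 <= \sum_(t <- ts) dev F t s ^+ 2.
Proof.
move=> m0; case: (boolP (all (fun t => `|dev F t s| < m) ts)).
  by move=> /allP h; left.
rewrite -has_predC => /hasP[t tts /=]; rewrite -leNgt => mt; right.
rewrite (big_rem t)//= -[leLHS]addr0 lerD ?sumr_ge0// => *; last exact: sqr_ge0.
by rewrite -(real_normK (num_real (dev F t s))) lerXn2r ?nnegrE.
Qed.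

(** On the eighth-root scale [r] all powers are integral: frequencies may deviate by [k / r ^+ 2],
    and losses are compared with the level [r ^+ 2]. The error is of order [r ^- 2] up to a factor
    [ln r], which the final [1 / r] absorbs. *)
Lemma le_iid_good_bad n (r k J0 : R) (ts : seq R) (f g : seq (R * R) -> R)
    (phi : R * R -> R) :
  (0 < n)%N -> n%:R = r ^+ 8 -> 1 <= r -> 0 < k -> 0 <= J0 ->
  all (fun t => 0 <= t) ts ->
  (forall s, sample n s -> 0 <= f s) -> (forall s, sample n s -> 0 <= g s) ->
  (forall z, 0 <= phi z) -> measurable_fun setT phi -> (J phi <= J0%:E)%E ->
  (forall s, sample n s ->
     (forall t, t \in ts -> `|dev F t s| < n%:R * (k / r ^+ 2)) ->
     f s <= g s + n%:R^-1 * \sum_(p <- s) phi p) ->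
  (forall s, sample n s -> f s <= n%:R^-1 * \sum_(p <- s)
     (below 2 (ln (n%:R / q)) p + above 2 (- ln q) p)) ->
  (iid F n (fun s => (f s)%:E) <= iid F n (fun s => (g s)%:E) +
    (J0 + (2 * 8 ^+ 4 * (72 - ln q) + (size ts)%:R / k ^+ 2) / r)%:E)%E.
Proof.
move=> n0 nr r1 k0 J00 ts0 f0 g0 phi0 mphi jphi hgood hbad.
have lnq0 := lnq_lt0 q_gt0 q_lt1.
have r0 : 0 < r by lra.
have nR : 0 < n%:R :> R by rewrite ltr0n.
set b := ln (n%:R / q) in hbad.
have bE : b = 8 * ln r - ln q.
  by rewrite /b ln_div ?posrE// nr lnXn// mulr_natl.
have lr0 : 0 <= ln r by exact: ln_ge0.
have lr : ln r <= r by apply: ltW; exact: ln_sublinear.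
have b0 : 0 <= b by rewrite bE; lra.
pose V z := below 4 b z + above 4 (- ln q) z.
have V0 z : 0 <= V z by rewrite addr_ge0 ?below_ge0 ?above_ge0.
have mV : measurable_fun setT V.
  by apply: measurable_funD; [exact: measurable_below|exact: measurable_above].
have jV : (J V <= (8 ^+ 4 * b + 64 * 8 ^+ 4)%:E)%E.
  apply: (@joint_leD _ F hF (below 4 b) (above 4 (- ln q))).
  - by move=> z; exact: below_ge0.
  - by move=> z; exact: above_ge0.
  - exact: measurable_above.
  - exact: joint_below4.
  - by apply: joint_above4 => //; lra.
pose la := (r ^+ 2)^-1.
have la0 : 0 < la by rewrite /la invr_gt0 exprn_gt0.
have ni0 : 0 <= n%:R^-1 :> R by rewrite invr_ge0.
pose phi' z := n%:R^-1 * (phi z + 2 * la * V z).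
have la2 : 0 <= 2 * la by lra.
have phiV z : 0 <= phi z + 2 * la * V z by rewrite addr_ge0// mulr_ge0.
have mlV : measurable_fun setT (fun z => 2 * la * V z).
  by apply: measurable_funM.
have jphi' : (J phi' <= (n%:R^-1 * (J0 + 2 * la * (8 ^+ 4 * b + 64 * 8 ^+ 4)))%:E)%E.
  apply: (@joint_leZ _ F hF (fun z => phi z + 2 * la * V z)) => //.
    exact: measurable_funD.
  apply: (@joint_leD _ F hF phi (fun z => 2 * la * V z)) => //.
  - by move=> z; rewrite mulr_ge0.
  - exact: joint_leZ.
(* Chosen so that [eta] times the square of the allowed deviation [n * k / r ^+ 2] is [r ^+ 2], the
   part of a loss that its square does not pay for on the bad event. *)
pose eta := r ^+ 6 / (n%:R * k) ^+ 2.
have eta0 : 0 <= eta by rewrite /eta divr_ge0 ?sqr_ge0// exprn_ge0// ltW.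
apply: le_trans (@le_iid_error _ F hF n _ (fun s => (g s)%:E) phi' _ eta ts
  _ _ _ _ jphi' eta0 ts0 _) _.
- by move=> s hs; rewrite lee_fin f0.
- by move=> s hs; rewrite lee_fin g0.
- by move=> z; rewrite mulr_ge0.
- by apply: measurable_funM => //; exact: measurable_funD.
- move=> s hs; rewrite -!EFinD lee_fin.
  have S0 : 0 <= \sum_(t <- ts) dev F t s ^+ 2 by apply: sumr_ge0 => *; exact: sqr_ge0.
  have m0 : 0 <= n%:R * (k / r ^+ 2) by rewrite !mulr_ge0 ?invr_ge0 ?sqr_ge0// ltW.
  have VS : 0 <= \sum_(p <- s) V p by exact: sumr_ge0.
  have PS : 0 <= \sum_(p <- s) phi p by exact: sumr_ge0.
  have phi'E : \sum_(p <- s) phi' p =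
      n%:R^-1 * \sum_(p <- s) phi p + n%:R^-1 * (2 * la * \sum_(p <- s) V p).
    by rewrite /phi' -mulr_sumr big_split /= mulrDr -mulr_sumr.
  have [good|bad] := dev_dichotomy ts s m0.
    apply: le_trans (hgood s hs good) _; rewrite phi'E.
    have := mulr_ge0 eta0 S0; have := mulr_ge0 ni0 (mulr_ge0 la2 VS); lra.
  apply: le_trans (hbad s hs) _.
  (* On the bad event, AM-GM gives [u <= la * u ^+ 2 + la^-1] for each loss [u], with [la^-1 = r ^+ 2]. *)
  have h1 : r ^+ 2 <= eta * \sum_(t <- ts) dev F t s ^+ 2.
    apply: le_trans (ler_wpM2l eta0 bad); rewrite le_eqVlt; apply/orP; left; apply/eqP.
    by rewrite /eta; field; rewrite !gt_eqF.
  have h2 : \sum_(p <- s) (below 2 b p + above 2 (- ln q) p) <=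
      2 * la * (\sum_(p <- s) V p) + n%:R * r ^+ 2.
    have /andP[/eqP <- _] := hs.
    have -> : (size s)%:R * r ^+ 2 = \sum_(p <- s) r ^+ 2.
      by rewrite big_const_seq count_predT iter_addr_0 mulr_natl.
    rewrite mulr_sumr -big_split /=; apply: ler_sum => p _.
    have := sqr_below_above (- ln q) b p; rewrite -/(V p).
    set u := (below 2 b p + _) => hu.
    have u2 : u <= la * u ^+ 2 + r ^+ 2.
      have lr2 : la * r ^+ 2 = 1 by rewrite mulVf// gt_eqF// exprn_gt0.
      have := mulr_ge0 (ltW la0) (sqr_ge0 (u - r ^+ 2)).
      have -> : la * (u - r ^+ 2) ^+ 2 = la * u ^+ 2 - 2 * u * (la * r ^+ 2) + (la * r ^+ 2) * r ^+ 2.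
        by ring.
      rewrite lr2; have u0 : 0 <= u by rewrite addr_ge0 ?below_ge0 ?above_ge0.
      lra.
    have := ler_wpM2l (ltW la0) hu; lra.
  have := ler_wpM2l ni0 h2; rewrite mulrDr mulKf ?gt_eqF// phi'E.
  have := mulr_ge0 ni0 PS; have := g0 s hs; lra.
rewrite leeD2l// lee_fin mulVKf ?gt_eqF//.
have e1 : eta * (size ts)%:R * n%:R = (size ts)%:R / k ^+ 2 * la.
  rewrite /eta nr /la; field; rewrite !gt_eqF//.
have la1 : la <= r^-1.
  by rewrite /la expr2 invfM -[leRHS]mulr1 ler_wpM2l ?invr_ge0 ?(ltW r0)// invf_le1.
(* Only [ln r <= r] is used: [b] is at most [(8 - ln q) * r], while [la] is [r ^- 2]. *)
have e2 : la * b <= (8 - ln q) / r.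
  have -> : la * b = (b / r) / r by rewrite /la; field; rewrite gt_eqF.
  rewrite ler_pM2r ?invr_gt0// ler_pdivrMr// bE.
  have : - ln q * 1 <= - ln q * r by rewrite ler_wpM2l//; lra.
  lra.
have s0 : 0 <= (size ts)%:R / k ^+ 2 by rewrite divr_ge0// sqr_ge0.
rewrite e1; have := ler_wpM2l s0 la1.
have p0 : 0 <= 2 * 8 ^+ 4 :> R by rewrite mulr_ge0// exprn_ge0.
have := ler_wpM2l p0 e2; have := ler_wpM2l p0 la1.
move: (8 ^+ 4) ((size ts)%:R / k ^+ 2) => c S; lra.
Qed.

Lemma tailE t : tail F t = expR (- t) * (expR t * tail F t).
Proof. by rewrite mulrA -expRD addNr expR0 mul1r. Qed.

Definition grid (h : R) (K : nat) : seq R := [seq j%:R * h | j <- iota 0 K].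

(** Excluding crossings on an interval needs a grid: from a grid point [u] to [t < u + h] the
    empirical tail can only decrease, and the level shrinks by a factor at least [1 - h]. Of the
    margin [d / 2 * (q^-1 - 1)], one eighth-of-[d] share pays for the deviation at [u] and another
    for the mesh. *)
Lemma good_lower n s (T0 A d h e : R) (K : nat) : (0 < n)%N -> sample n s ->
  0 < T0 -> T0 <= A -> (T0%:E <= Tq q (mixcdf F))%E -> 0 < d -> d <= 1 ->
  0 < h -> h / q <= d / 8 * (q^-1 - 1) -> A <= K%:R * h ->
  e <= expR (- A) * (d / 8 * (q^-1 - 1)) ->
  (forall t, t \in grid h K -> `|dev F t s| < n%:R * e) ->
  forall t, - ln q <= t -> t < (1 - d) * T0 -> 1 - Gn s t < q^-1 * expR (- t).
Proof.
move=> n0 hs T00 T0A T0T d0 d1 h0 hq AK eA good t tq tT.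
have lnq0 := lnq_lt0 q_gt0 q_lt1; have q1 := invq_gt1 q_gt0 q_lt1.
have nR : 0 < n%:R :> R by rewrite ltr0n.
have /andP[/eqP sn _] := hs.
have t0 : 0 <= t by lra.
have tA : t < A by nra.
pose j := Num.truncn (t / h); pose u := j%:R * h.
have /andP[jl ju] : j%:R <= t / h < j.+1%:R by apply: truncn_itv; rewrite divr_ge0// ltW.
have ut : u <= t by rewrite /u -ler_pdivlMr.
have tu : t < u + h by move: ju; rewrite ltr_pdivrMr// -natr1 mulrDl mul1r.
have jK : (j < K)%N.
  by rewrite -(ltr_nat R) -(ltr_pM2r h0); apply: le_lt_trans ut _; lra.
have u0 : 0 <= u by rewrite mulr_ge0// ltW.
have gu : u \in grid h K.
  by apply/mapP; exists j => //; rewrite mem_iota add0n.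
have := good u gu; rewrite ltr_norml => /andP[_ du].
apply: le_lt_trans (one_sub_Gn_nincr n0 sn ut) _.
rewrite (one_sub_Gn_dev _ n0 hs).
have dn : dev F u s / n%:R < e by rewrite ltr_pdivrMr// mulrC.
have uT : u <= (1 - d) * T0 by lra.
have Hu := tail_gap_below q_gt0 q_lt1 hF T00 T0T d0 d1 u0 uT.
have E0 := expR_gt0 (- u); set E := expR (- u) in E0 *.
have eu : expR (- A) <= E by rewrite ler_expR; lra.
have g0 : 0 <= d / 8 * (q^-1 - 1) by rewrite mulr_ge0//; lra.
have h1 : tail F u <= E * (q^-1 - d / 2 * (q^-1 - 1)) by rewrite tailE ler_pM2l.
have h2 : e <= E * (d / 8 * (q^-1 - 1)) by apply: le_trans eA _; rewrite ler_wpM2r.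
have h3 : E * (q^-1 * (1 - h)) <= q^-1 * expR (- t).
  have -> : q^-1 * expR (- t) = E * (q^-1 * expR (- (t - u))).
    by rewrite mulrCA -expRD; congr (_ * expR _); lra.
  rewrite ler_pM2l// ler_pM2l ?invr_gt0//.
  have := expR_ge1Dx (- (t - u)); lra.
have h4 : E * (h / q) <= E * (d / 8 * (q^-1 - 1)) by rewrite ler_pM2l.
have h5 : 0 <= E * (d / 8 * (q^-1 - 1)) by rewrite mulr_ge0// ltW.
move: h1 h2 h3 h4 h5; lra.
Qed.

(** One point suffices here, since exhibiting a single crossing bounds the infimum from above. *)
Lemma good_upper n s (T1 d e : R) : (0 < n)%N -> sample n s ->
  Tq q (mixcdf F) = T1%:E -> 0 < d -> d <= 1 ->
  e <= expR (- ((1 + d) * T1)) * (d / 8 * (q^-1 - 1)) ->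
  `|dev F ((1 + d) * T1) s| < n%:R * e ->
  q^-1 * expR (- ((1 + d) * T1)) <= 1 - Gn s ((1 + d) * T1).
Proof.
move=> n0 hs TT d0 d1 eb; set b := (1 + d) * T1; rewrite ltr_norml => /andP[db _].
have nR : 0 < n%:R :> R by rewrite ltr0n.
have Hb := tail_gap_above q_gt0 q_lt1 hF TT d0 d1.
rewrite (one_sub_Gn_dev _ n0 hs).
have dn : - e < dev F b s / n%:R by rewrite ltr_pdivlMr// mulNr mulrC.
have E0 := expR_gt0 (- b).
have h1 : expR (- b) * (q^-1 + d / 4 * (q^-1 - 1)) <= tail F b by rewrite tailE ler_pM2l.
have q1 := invq_gt1 q_gt0 q_lt1.
have h5 : 0 <= expR (- b) * (d / 8 * (q^-1 - 1)).
  by rewrite !mulr_ge0//; lra.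
clear TT; move: h1 eb h5; rewrite -/b; lra.
Qed.

End good_event.

(** * Sample losses, means over samples, and an infinite threshold *)

Section risks.
Context (R : realType) (q : R).
Hypotheses (q_gt0 : 0 < q) (q_lt1 : q < 1).

Local Notation J F phi := (joint F (fun mu x => (phi (mu, x))%:E)).

Definition sample_loss (n : nat) (s : seq (R * R)) : R :=
  n%:R^-1 * \sum_(p <- s) loss (That q n s) p.

Lemma sample_loss_ge0 n s : 0 <= sample_loss n s.
Proof. by rewrite mulr_ge0 ?invr_ge0// sumr_ge0// => *; exact: loss_ge0. Qed.

Lemma RnE n (F : probability R R) : Rn q n F = iid F n (fun s => (sample_loss n s)%:E).
Proof. by []. Qed.

Lemma iid_mean (F : probability R R) (n : nat) (phi : R * R -> R) (v : R) :
  F \in @priors R -> (0 < n)%N -> (forall z, 0 <= phi z) -> measurable_fun setT phi ->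
  J F phi = v%:E -> iid F n (fun s => (n%:R^-1 * \sum_(p <- s) phi p)%:E) = v%:E.
Proof.
move=> hF n0 phi0 mphi jv.
have ni0 : 0 <= n%:R^-1 :> R by rewrite invr_ge0.
have jn : J F (fun z => n%:R^-1 * phi z)%R = (n%:R^-1 * v)%:E.
  rewrite (jointZ (f := fun mu x => (phi (mu, x))%:E) hF ni0) ?jv//.
  - by move=> *; rewrite lee_fin.
  - exact: measurable_uncurry.
have := @iid_sum _ F hF n 0 _ (fun z => n%:R^-1 * phi z) (lexx _) _ _ jn.
rewrite add0r mulVKf ?pnatr_eq0 ?gtn_eqF// => <-//.
- by congr iid; apply/funext => s; rewrite add0r mulr_sumr.
- by move=> z; rewrite mulr_ge0.
- exact: measurable_funM.
Qed.

(* If the crossing never happens, [F] is the point mass at 1. *)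
Lemma joint_loss_infty (F : probability R R) : F \in @priors R ->
  Tq q (mixcdf F) = +oo%E -> J F (loss +oo%E) = 0%E.
Proof.
move=> hF TT; have q1 := invq_gt1 q_gt0 q_lt1.
pose v (mu : R) := (1 - mu^-1) ^+ 2.
have mv : measurable_fun (`[1%R, +oo[%classic : set R) (fun mu => (v mu)%:E).
  apply/measurable_EFinP; apply: measurable_funTS; apply: measurable_funX.
  by apply: measurable_funB => //; exact: measurable_invr.
have v0 : (\int[F]_(mu in `[1%R, +oo[) `|(v mu)%:E| = 0)%E.
  under eq_integral do rewrite gee0_abs ?lee_fin ?sqr_ge0//.
  apply/eqP; rewrite eq_le integral_ge0 ?andbT; last first.
    by move=> mu _; rewrite lee_fin sqr_ge0.
  apply/lee_addgt0Pr => e e0; rewrite add0e.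
  (* The bound [4 / (q * t ^+ 2)] is at most [e] because [e * t >= 4 / q] and [t >= 1]. *)
  pose t := 1 + 4 * q^-1 / e.
  have qe0 : 0 < 4 * q^-1 / e by rewrite divr_gt0//; lra.
  have t1 : 1 <= t by rewrite /t; lra.
  have t0 : 0 < t by lra.
  have tT : (t%:E < Tq q (mixcdf F))%E by rewrite TT ltry.
  have Ht := tail_below (ltW t0) tT.
  have k0 : 0 <= 4 / t ^+ 2 by rewrite divr_ge0// sqr_ge0.
  apply: (@le_trans _ _ (\int[F]_(mu in `[1%R, +oo[)
      ((4 / t ^+ 2)%:E * (expR (t * (1 - mu^-1)))%:E))%E).
    apply: le_integral_lower_in => mu /mem_itv1y mu1; first by rewrite lee_fin sqr_ge0.
    rewrite -EFinM lee_fin /v; have i1 : mu^-1 <= 1 by rewrite invf_le1//; lra.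
    have := @sqr_le_expR _ (t * (1 - mu^-1)).
    rewrite mulr_ge0 ?subr_ge0 ?(ltW t0)// => /(_ isT) h.
    by rewrite mulrAC ler_pdivlMr ?exprn_gt0// mulrC -exprMn.
  rewrite ge0_integralZl_EFin//; last exact: measurable_expR_scaled.
  rewrite (integral_expR_tail hF)//; last exact: ltW.
  rewrite -EFinM lee_fin; apply: (@le_trans _ _ (4 / t ^+ 2 * q^-1)).
    by rewrite ler_wpM2l// ltW.
  rewrite mulrAC ler_pdivrMr ?exprn_gt0//.
  have h1 : 4 * q^-1 <= e * t.
    have -> : e * t = e + 4 * q^-1 by rewrite /t; field; rewrite !gt_eqF.
    lra.
  apply: le_trans h1 _; rewrite ler_pM2l//; nra.
have mI : measurable (`[1%R, +oo[%classic : set R) by [].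
have {}vae := (ae_eq_integral_abs F mI mv).1 v0.
apply/eqP; rewrite eq_le joint_ge0// ?andbT; last first.
  by move=> *; rewrite lee_fin loss_ge0.
have -> : J F (loss +oo%E) = J F (fun z => ln z.1 ^+ 2)%R.
  apply: eq_joint => // mu x _ _; rewrite ?lee_fin ?loss_ge0//.
  by rewrite /loss /= ln1 sub0r sqrrN.
apply: (@le_trans _ _ (\int[F]_(mu in `[1%R, +oo[) ((ln mu ^+ 2)%:E))%E).
  apply: (@joint_le_integral _ F hF (fun z => ln z.1 ^+ 2) (fun mu => ln mu ^+ 2)).
    by move=> z; exact: sqr_ge0.
  move=> mu mu1 /=.
  rewrite ge0_integralZl_EFin ?sqr_ge0//; last first.
  - exact: measurable_dens1.
  - by move=> x _; rewrite lee_fin dens_ge0.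
  rewrite -[leRHS]mule1 lee_wpmul2l ?lee_fin ?sqr_ge0//.
  rewrite integral_itv_obnd_cbnd ?integral_dens_tail; last first.
  - exact: measurable_dens1.
  - by lra.
  by rewrite mul0r oppr0 expR0.
rewrite (ae_eq_integral (cst 0%E)) ?integral0//.
- apply/measurable_EFinP; apply: measurable_funTS; apply: measurable_funX.
  exact: measurable_ln.
- apply: filterS vae => mu h /[dup] /mem_itv1y mu1 /h [] /eqP.
  rewrite sqrf_eq0 subr_eq0 => /eqP e1; rewrite -[mu]invrK -e1 invr1 ln1.
  by rewrite expr0n.
Qed.

End risks.

(** * Moderate and large ideal thresholds *)

Section regimes.
Context (R : realType) (q : R) (F : probability R R).
Hypotheses (q_gt0 : 0 < q) (q_lt1 : q < 1) (hF : F \in @priors R).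
Variables (n K : nat) (r A d h : R).
Hypotheses (n_gt0 : (0 < n)%N) (nr : n%:R = r ^+ 8) (r_ge1 : 1 <= r).
Hypotheses (A_gt0 : 0 < A) (d_gt0 : 0 < d) (d_le : d <= 1 / 2) (h_gt0 : 0 < h).
Local Notation k := (d / 8 * (q^-1 - 1)).
Hypotheses (hq : h / q <= k) (AK : A <= K%:R * h).
Hypotheses (rA : expR A <= r) (rq : q^-1 <= r).
Local Notation J phi := (joint F (fun mu x => (phi (mu, x))%:E)).
Local Notation T := (Tq q (mixcdf F)).
Local Notation b1 := (ln (n%:R / q)).

(** Here 72 is 64, from the fourth moment above the threshold, plus 8, from
    [ln (n / q) = 8 * ln r - ln q] below it; [K.+1] counts the grid and one upper point. *)
Definition rate : R := 2 * 8 ^+ 4 * (72 - ln q) + K.+1%:R / k ^+ 2.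

Lemma gap_gt0 : 0 < k.
Proof.
have q1 := invq_gt1 q_gt0 q_lt1; have d0 := d_gt0.
by rewrite mulr_gt0//; lra.
Qed.

Lemma r_gt0 : 0 < r. Proof. exact: lt_le_trans ltr01 r_ge1. Qed.

Lemma b1E : b1 = 8 * ln r - ln q.
Proof.
have r0 := r_gt0; rewrite ln_div ?posrE ?ltr0n// nr lnXn// mulr_natl//.
Qed.

Lemma A_le_lnr : A <= ln r.
Proof. by rewrite -[leLHS]expRK ler_ln ?posrE ?expR_gt0 ?r_gt0. Qed.

Lemma lnq_le_lnr : - ln q <= ln r.
Proof. by rewrite -lnV ?posrE// ler_ln ?posrE ?invr_gt0 ?r_gt0. Qed.

Lemma dev_level (y : R) : y <= 2 * ln r -> k / r ^+ 2 <= expR (- y) * k.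
Proof.
move=> yr; rewrite mulrC ler_wpM2r ?(ltW gap_gt0)//.
have -> : (r ^+ 2)^-1 = expR (- (2 * ln r)).
  by rewrite expRN expRM_natl lnK ?posrE ?r_gt0.
by rewrite ler_expR lerN2.
Qed.

(** The lower bound only asks for some [T0 <= T] within reach of the grid, so it also serves when
    [T] is beyond [A] or infinite. The upper bound needs [T] up to [ln r] only, where the margin
    still exceeds the allowed deviation. *)
Lemma That_good (b : R) s : sample n s ->
  (forall t, t \in b :: grid h K -> `|dev F t s| < n%:R * (k / r ^+ 2)) ->
  exists tau, [/\ That q n s = tau%:E, tau <= b1,
    forall T0, 0 < T0 -> T0 <= A -> (T0%:E <= T)%E -> (1 - d) * T0 <= tau &
    forall T1, T = T1%:E -> T1 <= ln r -> b = (1 + d) * T1 -> tau <= b].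
Proof.
move=> hs good; have /andP[/eqP sn _] := hs.
have lnq0 := lnq_lt0 q_gt0 q_lt1.
have Ar := A_le_lnr.
have d0 := d_gt0; have d2 := d_le; have A0 := A_gt0.
have [tau [tauE tau0 taub1 tlow tup]] := That_fin q_gt0 q_lt1 n_gt0 sn.
exists tau; split => //; clear sn tauE.
  move=> T0 T00 T0A T0T; apply: tlow; first by rewrite b1E; nra.
  apply: (good_lower q_gt0 q_lt1 hF (n := n) (A := A) (d := d) (h := h) (e := k / r ^+ 2) (K := K)) => //.
  - by lra.
  - by apply: dev_level; lra.
  - by move=> t tg; apply: good; rewrite inE tg orbT.
move=> T1 TT T1r bE; rewrite bE.
have T1q : - ln q <= T1.
  by have := Tq_ge_lnq q_gt0 q_lt1 (mixcdf_ge0 F); rewrite TT lee_fin.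
apply: tup; first by clear TT; rewrite mulr_ge0//; lra.
apply: (good_upper q_gt0 q_lt1 hF (n := n) (e := k / r ^+ 2)) => //.
- by clear TT; lra.
- by apply: dev_level; clear TT; nra.
- by rewrite -bE; apply: good; rewrite inE eqxx.
Qed.

Lemma sample_loss_le s : sample n s ->
  sample_loss q n s <= n%:R^-1 * \sum_(p <- s) (below 2 b1 p + above 2 (- ln q) p).
Proof.
move=> hs; have /andP[/eqP sn _] := hs.
have [tau [tauE tau0 taub1 _ _]] := That_fin q_gt0 q_lt1 n_gt0 sn.
rewrite /sample_loss ler_wpM2l ?invr_ge0// tauE.
by apply: ler_sum => p _; exact: loss_le.
Qed.

Lemma all_grid (b : R) : 0 <= b -> all (fun t => 0 <= t) (b :: grid h K).
Proof.
by move=> b0 /=; rewrite b0; apply/allP => t /mapP[j _ ->]; rewrite mulr_ge0// ltW.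
Qed.

Lemma size_grid (b : R) : size (b :: grid h K) = K.+1.
Proof. by rewrite /= size_map size_iota. Qed.

(** The ideal risk is rewritten as a mean over the same sample, so the two losses are compared
    sample by sample; the two inequalities exchange the roles of [f] and [g] in
    [le_iid_good_bad]. *)
Lemma risk_moderate (T1 c : R) : T = T1%:E -> T1 <= A ->
  ln (2 * A) <= c -> - ln (- ln q / 2) <= c -> 0 <= c ->
  let err := (12 + 2 * c ^+ 2) * (2 * d * A) + rate / r in
  exists v, [/\ Rtilde q F = v%:E, (Rn q n F <= (v + err)%:E)%E &
    (v%:E <= Rn q n F + err%:E)%E].
Proof.
move=> TT T1A cA cq c0 err.
have lnq0 := lnq_lt0 q_gt0 q_lt1.
have d0 := d_gt0; have d2 := d_le; have A0 := A_gt0.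
have T1q : - ln q <= T1.
  by have := Tq_ge_lnq q_gt0 q_lt1 (mixcdf_ge0 F); rewrite TT lee_fin.
have Ar := A_le_lnr.
pose a := (1 - d) * T1; pose b := (1 + d) * T1.
have aq : - ln q / 2 <= a by rewrite /a; clear TT; nra.
have a0 : 0 < a by lra.
have bA : b <= 2 * A by rewrite /b; clear TT; nra.
have b0 : 0 < b by rewrite /b; clear TT; nra.
have aT : a <= T1 by rewrite /a; clear TT; nra.
have Tb : T1 <= b by rewrite /b; clear TT; nra.
have baA : b - a <= 2 * d * A by rewrite /b /a; clear TT; nra.
have M0 : 0 <= 12 + 2 * c ^+ 2 by have := sqr_ge0 c; lra.
have jD : (J (between a b) <= ((12 + 2 * c ^+ 2) * (2 * d * A))%:E)%E.
  apply: (@le_trans _ _ ((12 + 2 * c ^+ 2) * (b - a))%:E); last first.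
    by rewrite lee_fin ler_wpM2l.
  apply: joint_between => //.
  - by lra.
  - by apply: le_trans cA; rewrite ler_ln ?posrE//; lra.
  - by apply: le_trans cq; rewrite lerN2 ler_ln ?posrE//; lra.
have JD0 : 0 <= (12 + 2 * c ^+ 2) * (2 * d * A).
  by rewrite mulr_ge0//; clear TT; nra.
have [v vE] : exists v, J (loss T) = v%:E.
  (* Only finiteness is at stake, so the tail is read at the arbitrary point 1. *)
  have h1 : (J (below 2 b) <= (16 * b / 1 ^+ 2 * (expR 1 * tail F 1))%:E)%E.
    by apply: joint_below_tail => //; exact: ltW.
  have h2 : (J (above 2 a) <= (64 * 8 ^+ 2 * expR (- (a / 4)) * (expR a * tail F a))%:E)%E.
    exact: joint_above_tail.
  have : (J (loss T) <= (16 * b / 1 ^+ 2 * (expR 1 * tail F 1) +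
      64 * 8 ^+ 2 * expR (- (a / 4)) * (expR a * tail F a))%:E)%E.
    apply: le_trans (joint_leD hF (f := below 2 b) (g := above 2 a) _ _ _ h1 h2).
    - apply: le_joint => // mu x _ _; rewrite lee_fin ?loss_ge0//.
      by rewrite TT; exact: loss_le.
    - by move=> z; exact: below_ge0.
    - by move=> z; exact: above_ge0.
    - exact: measurable_above.
  have : (0 <= J (loss T))%E by apply: joint_ge0 => // *; rewrite lee_fin loss_ge0.
  by case: joint => [v| |] //= _ _; exists v.
have iidT : iid F n (fun s => (n%:R^-1 * \sum_(p <- s) loss T p)%:E) = v%:E.
  by apply: iid_mean => //; [move=> z; exact: loss_ge0|exact: measurable_loss].
have bal s : sample n s ->
    (forall t, t \in b :: grid h K -> `|dev F t s| < n%:R * (k / r ^+ 2)) ->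
    exists2 tau, That q n s = tau%:E & a <= tau <= b.
  move=> hs good; have [tau [tauE _ tl tu]] := That_good hs good.
  exists tau => //; rewrite tl ?(tu T1)//.
  - by apply: le_trans T1A _.
  - by lra.
  - by rewrite TT.
have ni0 : 0 <= n%:R^-1 :> R by rewrite invr_ge0.
exists v; split => //.
- rewrite EFinD -iidT RnE /err /rate -(size_grid b).
  apply: (le_iid_good_bad q_gt0 q_lt1 hF n_gt0 nr r_ge1 gap_gt0 JD0 _ _ _ _ _ jD).
  + by apply: all_grid; exact: ltW.
  + by move=> s hs; exact: sample_loss_ge0.
  + by move=> s hs; rewrite mulr_ge0// sumr_ge0// => *; exact: loss_ge0.
  + by move=> z; exact: between_ge0.
  + exact: measurable_between.
  + move=> s hs good; have [tau tauE /andP[atau taub]] := bal s hs good.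
    rewrite /sample_loss tauE TT -mulrDr -big_split /= ler_wpM2l//.
    by apply: ler_sum => p _; exact: loss_diff.
  + exact: sample_loss_le.
- rewrite -iidT RnE /err /rate -(size_grid b).
  apply: (le_iid_good_bad q_gt0 q_lt1 hF n_gt0 nr r_ge1 gap_gt0 JD0 _ _ _ _ _ jD).
  + by apply: all_grid; exact: ltW.
  + by move=> s hs; rewrite mulr_ge0// sumr_ge0// => *; exact: loss_ge0.
  + by move=> s hs; exact: sample_loss_ge0.
  + by move=> z; exact: between_ge0.
  + exact: measurable_between.
  + move=> s hs good; have [tau tauE /andP[atau taub]] := bal s hs good.
    rewrite /sample_loss tauE TT -mulrDr -big_split /= ler_wpM2l//.
    by apply: ler_sum => p _; exact: loss_diff.
  + move=> s hs; rewrite TT ler_wpM2l//; apply: ler_sum => p _.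
    by apply: loss_le => //; rewrite b1E; lra.
Qed.

(** With [b <= 9 * t] and [t >= A / 2], the term [16 * b / t ^+ 2] is at most [144 / t], hence at
    most [288 / A]; the factor [1 / q] bounds [H t]. *)
Definition sparse_bound : R :=
  288 / A / q + 64 * 8 ^+ 2 * expR (- (A / 8)) / q.

Lemma joint_sparse (t b : R) : A / 2 <= t -> (t%:E < T)%E -> 0 <= b -> b <= 9 * t ->
  (J (fun z => below 2 b z + above 2 (A / 2) z)%R <= sparse_bound%:E)%E.
Proof.
move=> At tT b0 bt; have A0 := A_gt0; have t0 : 0 < t by lra.
have Ht := ltW (tail_below (ltW t0) tT).
have qi0 : 0 < q^-1 by rewrite invr_gt0.
apply: (joint_leD hF).
- by move=> z; exact: below_ge0.
- by move=> z; exact: above_ge0.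
- exact: measurable_above.
- apply: le_trans (joint_below_tail hF b0 t0 Ht) _.
  rewrite lee_fin ler_pM2r// ler_pdivrMr ?exprn_gt0// mulrAC ler_pdivlMr//.
  clear tT; nra.
- have A20 : 0 < A / 2 by lra.
  apply: le_trans (joint_above_tail hF A20 At Ht) _.
  by rewrite (_ : A / 2 / 4 = A / 8)//; lra.
Qed.

Lemma risk_sparse : (A%:E < T)%E -> exists v, [/\ Rtilde q F = v%:E,
  0 <= v <= sparse_bound & (Rn q n F <= (sparse_bound + rate / r)%:E)%E].
Proof.
move=> AT; have d0 := d_gt0; have d2 := d_le; have A0 := A_gt0.
have lnq0 := lnq_lt0 q_gt0 q_lt1.
have hA : A / 2 <= (1 - d) * A by nra.
have Ar := A_le_lnr; have qr := lnq_le_lnr.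
have sb0 : 0 <= sparse_bound.
  have Ai : 0 <= A^-1 by rewrite invr_ge0 ltW.
  have qi : 0 <= q^-1 by rewrite invr_ge0 ltW.
  by rewrite addr_ge0 ?mulr_ge0 ?expR_ge0 ?exprn_ge0 ?ler0n ?Ai ?qi.
have Rt : (J (loss T) <= sparse_bound%:E)%E.
  move: (AT); case TT : T => [T1| |]; last 2 first.
  - by move=> _; rewrite (joint_loss_infty q_gt0 q_lt1 hF TT) lee_fin.
  - by [].
  rewrite lte_fin => AT1.
  (* The tail must be read strictly before the crossing [T1]; half of it is still at least
     [A / 2]. *)
  apply: le_trans (@joint_sparse (T1 / 2) T1 _ _ _ _).
  - apply: le_joint => // mu x _ _; rewrite lee_fin ?loss_ge0//.
    by apply: loss_le; clear TT; lra.
  - by clear TT; lra.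
  - by rewrite TT lte_fin; clear TT; lra.
  - by clear TT; lra.
  - by clear TT; lra.
have Rt0 : (0 <= J (loss T))%E by apply: joint_ge0 => // *; rewrite lee_fin loss_ge0.
have [v vE] : exists v, J (loss T) = v%:E.
  by move: Rt Rt0; case: joint => [v| |] //= _ _; exists v.
exists v; split => //; first by rewrite -!lee_fin -vE Rt0.
(* Up to [ln r], concentration caps the empirical threshold at [b = (1 + d) * T1]. Beyond, the
   deterministic cap [8 * ln r - ln q] is at most [9 * ln r], and [t = ln r] is still below [T];
   this is the origin of the factor 9. *)
have [t [b [At tT b0 bt btau]]] : exists t b, [/\ A / 2 <= t, (t%:E < T)%E, 0 <= b,
    b <= 9 * t & b = b1 \/ exists2 T1, T = T1%:E & T1 <= ln r /\ b = (1 + d) * T1].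
  case: (leP T (ln r)%:E) => Tr; last first.
    by exists (ln r), b1; split; rewrite ?b1E//; [lra|lra|lra|left].
  move: AT Tr; case TT : T => [T1| |] //; rewrite lte_fin lee_fin => AT1 T1r.
  exists (T1 / 2), ((1 + d) * T1); split.
  - by clear TT; lra.
  - by rewrite lte_fin; clear TT; lra.
  - by clear TT; rewrite mulr_ge0//; lra.
  - by clear TT; nra.
  - by right; exists T1.
have jU := joint_sparse At tT b0 bt.
have := le_iid_good_bad q_gt0 q_lt1 hF n_gt0 nr r_ge1 gap_gt0 sb0
  (phi := fun z => below 2 b z + above 2 (A / 2) z)
  (ts := b :: grid h K) (f := sample_loss q n) (g := fun=> 0)
  (all_grid b0) _ _ _ _ jU _ _.
rewrite size_grid -/rate; set X := (X in (_ <= X + _)%E).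
have -> : X = 0%E.
  rewrite /X; elim: {1}n => [|m IH] //=.
  rewrite (_ : (fun mu x => _) = fun _ _ => 0%E); last by apply/funext => ?; apply/funext => ?.
  exact: joint_cst.
rewrite add0e RnE; apply => //.
- by move=> s hs; exact: sample_loss_ge0.
- by move=> z; rewrite addr_ge0 ?below_ge0 ?above_ge0.
- by apply: measurable_funD; [exact: measurable_below|exact: measurable_above].
- move=> s hs good; rewrite add0r /sample_loss ler_wpM2l ?invr_ge0//.
  have [tau [tauE tb1 tl tu]] := That_good hs good.
  rewrite tauE; apply: ler_sum => p _; apply: loss_le.
    exact: le_trans hA (tl A A_gt0 (lexx _) (ltW AT)).
  by case: btau => [->//|[T1 TT [T1r bE]]]; exact: (tu T1).
- exact: sample_loss_le.
Qed.

End regimes.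

(** * Choice of constants and the limit *)

Section uniform_convergence.
Context (R : realType) (q : R) (hq0 : 0 < q) (hq1 : q < 1).

(** Uniformity lies in the order of choice: [A], then [d], the mesh [h], the grid size [K] and
    finally [r0], all from [eps] and [q] before any prior is given. *)
Lemma risk_uniform (eps : R) : 0 < eps -> exists r0 : R, 1 <= r0 /\
  forall (n : nat) (r : R) (F : probability R R), (0 < n)%N -> n%:R = r ^+ 8 ->
    r0 <= r -> F \in @priors R ->
    (`|Rn q n F - Rtilde q F| <= eps%:E)%E.
Proof.
move=> e0; have q1 := invq_gt1 hq0 hq1; have lnq0 := lnq_lt0 hq0 hq1.
(* After [expR (- (A / 8)) <= 8 / A], [sparse_bound] is at most [M / (A * q)]; the choice of [A]
   makes this at most [eps / 2]. *)
pose M : R := 288 + 64 * 8 ^+ 2 * 8.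
have M0 : 0 < M by rewrite /M addr_gt0 ?mulr_gt0 ?exprn_gt0 ?ltr0n.
pose A : R := 1 + 2 * M / (q * eps).
have A1 : 1 <= A by rewrite lerDl divr_ge0 ?mulr_ge0 ?(ltW M0) ?(ltW hq0) ?(ltW e0).
have A0 : 0 < A by lra.
pose c : R := `|ln (2 * A)| + `|ln (- ln q / 2)|.
have c0 : 0 <= c by rewrite addr_ge0.
pose M2 : R := 12 + 2 * c ^+ 2.
have M20 : 0 < M2 by rewrite /M2; have := sqr_ge0 c; lra.
(* One denominator for two requirements: [d <= 1 / 2], and an interval error [M2 * (2 * d * A)] of
   at most [eps / 2]. *)
pose D : R := 4 * A * M2 + 2 * eps.
have D0 : 0 < D by rewrite /D addr_gt0 ?mulr_gt0.
pose d : R := eps / D.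
have d0 : 0 < d by rewrite divr_gt0.
have AM : 0 < A * M2 by rewrite mulr_gt0.
have dh : d <= 1 / 2.
  by rewrite /d ler_pdivrMr// /D; lra.
have dM : M2 * (2 * d * A) <= eps / 2.
  have -> : M2 * (2 * d * A) = eps * (2 * A * M2) / D by rewrite /d; ring.
  by rewrite ler_pdivrMr// /D; nra.
pose k : R := d / 8 * (q^-1 - 1).
have k0 : 0 < k by rewrite /k mulr_gt0//; lra.
pose h : R := q * k.
have h0 : 0 < h by rewrite mulr_gt0.
have hq : h / q <= k by rewrite /h mulrAC divff ?mul1r// gt_eqF.
pose K := (Num.truncn (A / h)).+1.
have AK : A <= K%:R * h.
  rewrite -ler_pdivrMr//; apply: ltW.
  by have /andP[] : _ <= A / h < _ := truncn_itv (divr_ge0 (ltW A0) (ltW h0)).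
pose C : R := rate q K d.
have C0 : 0 <= C.
  rewrite /C /rate addr_ge0 ?divr_ge0 ?sqr_ge0//.
  rewrite !mulr_ge0 ?exprn_ge0//; lra.
exists (1 + expR A + q^-1 + 2 * C / eps).
have Ce : 0 <= 2 * C / eps by rewrite divr_ge0 ?mulr_ge0 ?(ltW e0).
have EA := expR_gt0 A.
split; first by lra.
move=> n r F n0 nr hr hF.
have r1 : 1 <= r by lra.
have r0 : 0 < r by lra.
have rA : expR A <= r by lra.
have rq : q^-1 <= r by lra.
have Cr : C / r <= eps / 2.
  have : 2 * C / eps <= r by lra.
  by rewrite !ler_pdivrMr//; lra.
have sb : sparse_bound q A <= eps / 2.
  have e8 : expR (- (A / 8)) <= 8 / A.
    rewrite expRN -[leRHS]invf_div lef_pV2 ?posrE ?expR_gt0 ?divr_gt0//.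
    by have := expR_ge1Dx (A / 8); lra.
  apply: (@le_trans _ _ (M / (A * q))).
    rewrite /sparse_bound /M.
    have -> : (288 + 64 * 8 ^+ 2 * 8) / (A * q) =
        288 / A / q + 64 * 8 ^+ 2 * (8 / A) / q.
      by field; rewrite !gt_eqF.
    by rewrite lerD2l ler_pM2r ?invr_gt0// ler_pM2l// mulr_gt0 ?exprn_gt0.
  rewrite ler_pdivrMr ?mulr_gt0//.
  have -> : eps / 2 * (A * q) = eps * q / 2 + M.
    by rewrite /A; field; rewrite !gt_eqF.
  by rewrite lerDr divr_ge0// mulr_ge0// ltW.
have absle (v w : R) : (v%:E <= w%:E + eps%:E)%E -> (w%:E <= (v + eps)%:E)%E ->
    (`|w%:E - v%:E| <= eps%:E)%E.
  move=> h1; rewrite lee_fin => h2; move: h1; rewrite -[leRHS]EFinD lee_fin => h1.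
  by rewrite -EFinB abse_EFin lee_fin ler_norml; lra.
have Rn0 : (0 <= Rn q n F)%E.
  by rewrite RnE; apply: iid_ge0 => // s hs; rewrite lee_fin sample_loss_ge0.
case: (leP (Tq q (mixcdf F)) A%:E) => TA.
  have [T1 TT T1A] : exists2 T1, Tq q (mixcdf F) = T1%:E & T1 <= A.
    have := Tq_ge_lnq hq0 hq1 (mixcdf_ge0 F).
    by move: TA; case: (Tq q (mixcdf F)) => [T1| |] // hT _; exists T1.
  have cA : ln (2 * A) <= c.
    by clear TT; rewrite /c; have := ler_norm (ln (2 * A)); have := normr_ge0 (ln (- ln q / 2)); lra.
  have cq : - ln (- ln q / 2) <= c.
    by clear TT; rewrite /c; have := ler_norm (- ln (- ln q / 2)); rewrite normrN; have := normr_ge0 (ln (2 * A)); lra.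
  have [v [-> up lo]] := risk_moderate hq0 hq1 hF n0 nr r1 A0 d0 dh h0 hq AK rA
    TT T1A cA cq c0; clear TT.
  have err : (12 + 2 * c ^+ 2) * (2 * d * A) + rate q K d / r <= eps.
    by rewrite -/M2 -/C; lra.
  move: up lo; case: (Rn q n F) Rn0 => [w| |] //= _ up lo.
  apply: absle; first by apply: le_trans lo _; rewrite leeD2l// lee_fin.
  by apply: le_trans up _; rewrite lee_fin lerD2l.
have [v [-> /andP[v0 vb] up]] := risk_sparse hq0 hq1 hF n0 nr r1 A0 d0 dh h0 hq AK rA rq TA.
have err : sparse_bound q A + rate q K d / r <= eps by rewrite -/C; lra.
move: up Rn0; case: (Rn q n F) => [w| |] //; rewrite !lee_fin => up w0.
apply: absle; rewrite -?EFinD lee_fin; lra.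
Qed.

(** Nonemptiness keeps the supremum nonnegative, that of the empty set being [-oo]; the point mass
    at 1 will provide it for every class. *)
Lemma sup_risk_cvg (P : set (probability R R)) : P !=set0 -> P `<=` @priors R ->
  (fun n : nat => ereal_sup [set `| (Rn q n F - Rtilde q F)%E |%E | F in P])
    @ \oo --> 0%E.
Proof.
move=> [F0 PF0] Pp; set u := (fun n : nat => _).
have u0 n : (0 <= u n)%E.
  by apply: ereal_sup_ge; exists `|Rn q n F0 - Rtilde q F0|%E => //; exists F0.
have ub (eps : R) : 0 < eps -> \forall n \near \oo, (u n <= eps%:E)%E.
  move=> e0; have [r0 [r1 hr]] := risk_uniform e0.
  exists (Num.truncn (r0 ^+ 8)).+1 => // n /= hn.
  have n0 : (0 < n)%N by apply: leq_trans hn.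
  have rn : r0 ^+ 8 <= n%:R.
    apply: ltW; apply: lt_le_trans (_ : (Num.truncn (r0 ^+ 8)).+1%:R <= _).
      have r8 : 0 <= r0 ^+ 8 by rewrite exprn_ge0//; lra.
      by have /andP[] := truncn_itv r8.
    by rewrite ler_nat.
  pose r : R := expR (ln n%:R / 8).
  have nr : n%:R = r ^+ 8.
    by rewrite /r -expRM_natl mulrCA divff// mulr1 lnK// posrE ltr0n.
  have r0r : r0 <= r.
    rewrite -(ler_pXn2r (n := 8)) ?nnegrE ?expR_ge0// -?nr//; lra.
  apply: ge_ereal_sup => _ [F PF <-]; apply: (hr n r F) => //.
  by rewrite inE; exact: Pp.
apply/fine_cvgP; split.
  near=> n; rewrite ge0_fin_numE//; apply: le_lt_trans (ltry 1).
  by near: n; exact: ub.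
apply/cvgrPdist_le => eps e0; near=> n.
have : (u n <= eps%:E)%E by near: n; exact: ub.
rewrite sub0r normrN /=; have := u0 n; case: (u n) => [w| |] //=.
by rewrite !lee_fin => w0 we; rewrite ger0_norm.
Unshelve. all: by end_near. Qed.

Lemma dirac1_prior (p eta : R) : 0 < p ->
  priors_p p eta (dirac (1 : R) : probability R R).
Proof.
move=> p0; have h : (dirac (1 : R) : probability R R) \in @priors R.
  by rewrite inE /priors /= diracE mem_set//= in_itv/= lexx.
split => //; rewrite integral_dirac//; last first.
  apply/measurable_EFinP.
  exact: (measurableT_comp (measurable_powR p) (@measurable_ln R)).
by rewrite diracT mul1e ln1 powR0 ?gt_eqF// lee_fin powR_ge0.
Qed.

End uniform_convergence.

Unset Implicit Arguments.

Theorem theorem6p1 (R : realType) (q : R) (hq0 : 0 < q) (hq1 : q < 1) :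
  (fun n : nat => ereal_sup
      [set `| (Rn q n F - Rtilde q F)%E |%E | F in @priors R]) @ \oo --> 0%E
  /\
  (forall p eta : R, 0 < p -> p < 2 -> 0 < eta ->
    (fun n : nat => ereal_sup
      [set `| (Rn q n F - Rtilde q F)%E |%E | F in priors_p p eta]) @ \oo --> 0%E).
Proof.
have ne : forall p eta : R, 0 < p -> priors_p p eta !=set0.
  by move=> p eta p0; exists (dirac (1 : R) : probability R R); exact: dirac1_prior.
have sub : forall p eta : R, priors_p p eta `<=` @priors R.
  by move=> p eta F [/set_mem].
split=> [|p eta p0 _ _]; apply: sup_risk_cvg => //.
- by have [F /sub hF] := ne 1 1 ltr01; exists F.
- exact: ne.
Qed.
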